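(* Let $n\ge 2$, $\rho=\frac{n-1}{2}$ and $\beta>0$. Suppose $u$ is a nonnegative eigenfunction of the Laplace-Beltrami operator $\Delta_{\mathbb{H}^n}$ on $\mathbb{H}^n$ with eigenvalue $\beta^2-\rho^2$ and with boundary measure $\mu$. If there exist $x_0\in\mathbb{R}^{n-1}$ and $L\in[0,\infty)$ such that $$\lim_{y\to 0}y^{\beta-\rho}u(x_0,y)=L,$$ then $D_{sym}\mu(x_0)=L$ (that is, the symmetric derivative exists at $x_0$ and equals $L$).
   Context: $\mathbb{H}^n=\{(x,y): x\in\mathbb{R}^{n-1},\ y\in(0,\infty)\}$, $n\ge2$, is the upper half space model of real hyperbolic space with metric $ds^2=y^{-2}(dx^2+dy^2)$, and $\Delta_{\mathbb{H}^n}=y^2\left(\Delta_x+\frac{\partial^2}{\partial y^2}\right)-(n-2)y\frac{\partial}{\partial y}$, where $\Delta_x$ is the Euclidean Laplacian on $\mathbb{R}^{n-1}$; $u$ is an eigenfunction with eigenvalue $\beta^2-\rho^2$ if $\Delta_{\mathbb{H}^n}u=(\beta^2-\rho^2)u$. For $\beta>0$ define the normalized generalized Poisson kernel $$P_{i\beta}(x,y)=d_{i\beta}\left[\frac{y}{y^2+\|x\|^2}\right]^{\rho+\beta},\qquad (x,y)\in\mathbb{H}^n,$$ where the constant $d_{i\beta}>0$ is chosen so that $\int_{\mathbb{R}^{n-1}}P_{i\beta}(x,1)\,dx=1$. For a positive measure $\mu$ on $\mathbb{R}^{n-1}$, $P_{i\beta}\mu(x,y)=\int_{\mathbb{R}^{n-1}}P_{i\beta}(x-\xi,y)\,d\mu(\xi)$.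 Boundary measure: it is known that if $u$ is a nonnegative eigenfunction of $\Delta_{\mathbb{H}^n}$ with eigenvalue $\beta^2-\rho^2$, $\beta>0$, then there exist a unique positive Radon measure $\mu$ on $\mathbb{R}^{n-1}$ (a nonnegative Borel measure finite on compact sets) and a constant $C\ge0$ such that $u(x,y)=Cy^{\beta+\rho}+P_{i\beta}\mu(x,y)$ for all $(x,y)\in\mathbb{H}^n$. This $\mu$ is called the boundary measure of $u$. The symmetric derivative of $\mu$ at $x_0\in\mathbb{R}^{n-1}$ is $D_{sym}\mu(x_0)=\lim_{r\to0}\frac{\mu(B(x_0,r))}{m(B(x_0,r))}$, provided the limit exists, where $B(x_0,r)$ is the Euclidean ball in $\mathbb{R}^{n-1}$ and $m$ is Lebesgue measure on $\mathbb{R}^{n-1}$. *)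

(* Defs.v *)
From HB Require Import structures.
From mathcomp Require Import all_boot all_order all_algebra.
From mathcomp Require Import all_classical all_reals all_analysis.
From mathcomp Require Import measurable_realfun.

Set Implicit Arguments.
Unset Strict Implicit.
Unset Printing Implicit Defensive.

Import Order.TTheory GRing.Theory Num.Theory.
Import numFieldNormedType.Exports.

Local Open Scope classical_set_scope.
Local Open Scope ring_scope.

(* R^m with its Borel sigma-algebra. *)
Definition borelRn (R : realType) (m : nat) :=
  g_sigma_algebraType (@open 'rV[R]_m).

Section lebesgue_tuple_step.
Local Open Scope ereal_scope.
Context (R : realType) (m : nat).
Variable mu : {sigma_finite_measure set (m.-tuple (measurableTypeR R)) -> \bar R}.

Definition cons_pair (p : measurableTypeR R * m.-tuple (measurableTypeR R)) :
  m.+1.-tuple (measurableTypeR R) := [tuple of p.1 :: p.2].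

Lemma measurable_cons_pair : measurable_fun setT cons_pair.
Proof. exact: measurable_cons. Qed.
#[local] Hint Resolve measurable_cons_pair : core.

Definition lebesgue_tuple_step :
    set (m.+1.-tuple (measurableTypeR R)) -> \bar R :=
  pushforward (lebesgue_measure \x mu) cons_pair.

Let step0 : lebesgue_tuple_step set0 = 0.
Proof. exact: measure0. Qed.

Let step_ge0 A : 0 <= lebesgue_tuple_step A.
Proof. exact: measure_ge0. Qed.

Let step_sigma_additive : semi_sigma_additive lebesgue_tuple_step.
Proof. exact: measure_semi_sigma_additive. Qed.

HB.instance Definition _ := isMeasure.Build _ _ _ lebesgue_tuple_step
  step0 step_ge0 step_sigma_additive.

Let step_sigma_finite : sigma_finite setT lebesgue_tuple_step.
Proof.
pose l : {sigma_finite_measure set (measurableTypeR R) -> \bar R} :=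
  @lebesgue_measure R.
have [F TF Foo] : sigma_finite setT (lebesgue_measure \x mu).
  have /sigma_finiteP[F [TF ndF Foo]] := sigma_finiteT l.
  have /sigma_finiteP[G [TG ndG Goo]] := sigma_finiteT mu.
  exists (fun n => F n `*` G n).
    apply/esym; rewrite -subTset => -[x t] _.
    have [i _ Fx] : (\bigcup_i F i) x by rewrite -TF.
    have [j _ Gt] : (\bigcup_i G i) t by rewrite -TG.
    exists (maxn i j) => //; split.
      by move: x Fx; exact/subsetPset/ndF/leq_maxl.
    by move: t Gt; exact/subsetPset/ndG/leq_maxr.
  move=> k; have [? ?] := Foo k; have [? ?] := Goo k.
  split; first exact: measurableX.
  by rewrite product_measure1E// lte_mul_pinfty// ge0_fin_numE.
pose g (t : m.+1.-tuple (measurableTypeR R)) := (thead t, [tuple of behead t]).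
have mg : measurable_fun setT g.
  by apply/measurable_fun_pair; [exact: measurable_tnth|exact: measurable_behead].
have Kg p : g (cons_pair p) = p.
  by case: p => x t; congr (_, _) => //; apply/val_inj.
exists (fun n => g @^-1` F n).
  by rewrite -preimage_bigcup -TF preimage_setT.
move=> n; have [mFn Fnoo] := Foo n; split.
  by rewrite -[X in measurable X]setTI; exact: mg.
rewrite /lebesgue_tuple_step /pushforward -comp_preimage.
by rewrite (_ : g \o cons_pair = id) //; apply/funext => p /=; rewrite Kg.
Qed.

HB.instance Definition _ := Measure_isSigmaFinite.Build _ _ _
  lebesgue_tuple_step step_sigma_finite.

End lebesgue_tuple_step.

Fixpoint lebesgue_tuple (R : realType) (m : nat) :
    {sigma_finite_measure set (m.-tuple (measurableTypeR R)) -> \bar R} :=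
  match m with
  | 0 => \d_([tuple] : 0.-tuple (measurableTypeR R))
  | m'.+1 => lebesgue_tuple_step (lebesgue_tuple R m')
  end.

Definition row_of_tuple (R : realType) (m : nat)
    (t : m.-tuple (measurableTypeR R)) : borelRn R m :=
  \row_(i < m) tnth t i.

Section row_of_tuple_measurable.
Context (R : realType) (m : nat).

Lemma open_rV_bigcup_ball (U : set 'rV[R]_m) : open U ->
  U = \bigcup_(qk in [set qk : 'rV[rat]_m * nat |
        ball (map_mx ratr qk.1 : 'rV[R]_m) qk.2.+1%:R^-1 `<=` U])
      ball (map_mx ratr qk.1 : 'rV[R]_m) qk.2.+1%:R^-1.
Proof.
move=> oU; apply/seteqP; split=> [x Ux|x [qk /= sU]]; last exact: sU.
have /nbhs_ballP [e /= e0 sU] : nbhs x U by exact: open_nbhs_nbhs.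
have [k ke] : exists k : nat, k.+1%:R^-1 < e / 2 :> R.
  have e20 : 0 < e / 2 by rewrite divr_gt0.
  have [k _ /(_ k (leqnn k))] := near_infty_natSinv_lt (PosNum e20).
  by exists k.
have k0 : 0 < k.+1%:R^-1 :> R by rewrite invr_gt0.
have /choice [q xq] (i : 'I_m) : exists r : rat, ball (x ord0 i) k.+1%:R^-1 (ratr r).
  have [y [xy [r _ ry]]] := @dense_rat R (ball (x ord0 i) k.+1%:R^-1)
    (ex_intro _ _ (ballxx _ k0)) (ball_open _ _).
  by exists r; rewrite ry.
have qx : ball (map_mx ratr (\row_i q i) : 'rV[R]_m) k.+1%:R^-1 x.
  by split=> // i j; rewrite !mxE ord1; exact/ball_sym/xq.
exists (\row_i q i, k) => //= y qy; apply: sU.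
apply: (@le_ball _ _ _ (k.+1%:R^-1 + k.+1%:R^-1)).
  by rewrite [leRHS]splitr ltW// ltrD.
by apply: ball_triangle qy; exact: ball_sym.
Qed.

Lemma measurable_row_of_tuple : measurable_fun setT (@row_of_tuple R m).
Proof.
apply: (@measurability _ _ _ (borelRn R m) _ _
  (@open 'rV[R]_m : set (set (borelRn R m)))) => //.
move=> _ [U oU <-]; rewrite setTI (open_rV_bigcup_ball oU) preimage_bigcup.
rewrite bigcup_mkcond; apply: countable_bigcupT_measurable => [|qk].
  exact: countableP.
case: ifP => // _.
rewrite (_ : _ @^-1` _ = \bigcap_(i in [set: 'I_m])
    (fun t : m.-tuple (measurableTypeR R) => tnth t i) @^-1`
      ball (ratr (qk.1 ord0 i) : R) qk.2.+1%:R^-1); last first.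
  apply/seteqP; split=> t /=.
    by move=> [_ tq] i _; have := tq ord0 i; rewrite !mxE.
  by move=> tq; split=> [|i j]; rewrite ?invr_gt0// !mxE ord1; exact: tq.
apply: fin_bigcap_measurable => // i _; rewrite -[X in measurable X]setTI.
by apply: measurable_tnth => //; exact: measurable_ball.
Qed.
End row_of_tuple_measurable.
#[local] Hint Resolve measurable_row_of_tuple : core.

(* Lebesgue measure on R^m: the m-fold product of lebesgue_measure, carried to
   row vectors.  See lebesgueRn_box for its value on boxes. *)
Definition lebesgueRn (R : realType) (m : nat) : set (borelRn R m) -> \bar R :=
  pushforward (lebesgue_tuple R m) (@row_of_tuple R m).

Section lebesgueRn_measure.
Context (R : realType) (m : nat).

Let lebesgueRn0 : lebesgueRn (set0 : set (borelRn R m)) = 0%E.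
Proof. exact: measure0. Qed.

Let lebesgueRn_ge0 (A : set (borelRn R m)) : (0 <= lebesgueRn A)%E.
Proof. exact: measure_ge0. Qed.

Let lebesgueRn_sigma_additive : semi_sigma_additive (@lebesgueRn R m).
Proof. exact: measure_semi_sigma_additive. Qed.

HB.instance Definition _ := isMeasure.Build _ _ _ (@lebesgueRn R m)
  lebesgueRn0 lebesgueRn_ge0 lebesgueRn_sigma_additive.

End lebesgueRn_measure.

Lemma lebesgue_tuple_box (R : realType) (m : nat) (A : 'I_m -> set R) :
  (forall i, measurable (A i)) ->
  lebesgue_tuple R m [set t | forall i, A i (tnth t i)] =
  (\prod_(i < m) lebesgue_measure (A i))%E.
Proof.
elim: m A => [|m IHm] A mA.
  by rewrite big_ord0 /= diracE mem_set//= => -[].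
rewrite big_ord_recl -IHm// /lebesgue_tuple -/lebesgue_tuple.
have mB : measurable
    [set t : m.-tuple (measurableTypeR R) | forall i, A (lift ord0 i) (tnth t i)].
  rewrite (_ : [set _ | _] = \bigcap_(i in [set: 'I_m])
    (fun t : m.-tuple (measurableTypeR R) => tnth t i) @^-1` A (lift ord0 i)).
    apply: fin_bigcap_measurable => // i _; rewrite -[X in measurable X]setTI.
    by apply: measurable_tnth => //; exact: mA.
  by apply/seteqP; split=> t /= tA; [move=> i _|move=> i]; exact: tA.
transitivity ((@lebesgue_measure R \x lebesgue_tuple R m)%E (A ord0 `*`
    [set t : m.-tuple (measurableTypeR R) | forall i, A (lift ord0 i) (tnth t i)]));
  last by rewrite product_measure1E//; exact: mA.
rewrite /= /lebesgue_tuple_step /pushforward; congr (product_measure1 _ _ _).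
apply/seteqP; split=> -[x t] /= => [tA|[Ax At] i].
  split=> [|i]; first exact: (tA ord0).
  by have := tA (lift ord0 i); rewrite tnthS.
by case: (unliftP ord0 i) => [j|] ->; rewrite ?tnthS//; exact: At.
Qed.

Lemma lebesgueRn_box (R : realType) (m : nat) (A : 'I_m -> set R) :
  (forall i, measurable (A i)) ->
  lebesgueRn ([set x | forall i, A i (x ord0 i)] : set (borelRn R m)) =
  (\prod_(i < m) lebesgue_measure (A i))%E.
Proof.
move=> mA; rewrite -lebesgue_tuple_box// /lebesgueRn /pushforward.
by congr (lebesgue_tuple _ _ _); apply/seteqP; split=> t /= tA i;
  have := tA i; rewrite mxE.
Qed.

Definition enorm (R : realType) (m : nat) (x : 'rV[R]_m) : R :=
  Num.sqrt (\sum_(i < m) x ord0 i ^+ 2).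

(* ball of the library is the sup-norm ball on row vectors. *)
Definition eball (R : realType) (m : nat) (x : 'rV[R]_m) (r : R) :
  set 'rV[R]_m := [set z | enorm (z - x) < r].

Section half_space.
Context (R : realType) (n : nat).

Definition half_space : set ('rV[R]_n.-1 * R) := [set p | 0 < p.2].

Definition rho : R := (n%:R - 1) / 2.

(* C^2 on the (open) half space: f and all its iterated directional
   derivatives of order at most two exist and are continuous there. *)
Definition C2_half_space (f : 'rV[R]_n.-1 * R -> R) :=
  forall p, half_space p ->
    {for p, continuous f} /\
    forall v, [/\ derivable f p v, {for p, continuous ('D_v f)} &
      forall w, derivable ('D_v f) p w /\ {for p, continuous ('D_w ('D_v f))}].

Definition dirx (i : 'I_n.-1) : 'rV[R]_n.-1 * R := (delta_mx ord0 i, 0).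
Definition diry : 'rV[R]_n.-1 * R := (0, 1).

(* Laplace-Beltrami operator of the metric y^-2 (dx^2 + dy^2), in the
   coordinates p = (x, y). *)
Definition laplacianH (f : 'rV[R]_n.-1 * R -> R) (p : 'rV[R]_n.-1 * R) : R :=
  p.2 ^+ 2 *
    (\sum_(i < n.-1) 'D_(dirx i) ('D_(dirx i) f) p + 'D_diry ('D_diry f) p)
  - (n%:R - 2) * p.2 * 'D_diry f p.

(* Functions on H^n are represented by total functions; the half space being
   open, the values of f outside it play no role. *)
Definition eigenfunctionH (lambda : R) (f : 'rV[R]_n.-1 * R -> R) :=
  C2_half_space f /\
  forall p, half_space p -> laplacianH f p = lambda * f p.

Definition poisson_profile (beta : R) (x : 'rV[R]_n.-1) (y : R) : R :=
  (y / (y ^+ 2 + enorm x ^+ 2)) `^ (rho + beta).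

(* d_{i beta}: the constant normalizing the kernel at height y = 1. *)
Definition poisson_const (beta : R) : R :=
  get [set d : R | 0 < d /\
    (\int[@lebesgueRn R n.-1]_x (d * poisson_profile beta x 1)%:E = 1)%E].

Definition poisson_kernel (beta : R) (x : 'rV[R]_n.-1) (y : R) : R :=
  poisson_const beta * poisson_profile beta x y.

Definition poisson_transform (beta : R)
    (mu : {measure set (borelRn R n.-1) -> \bar R})
    (x : 'rV[R]_n.-1) (y : R) : \bar R :=
  (\int[mu]_xi (poisson_kernel beta (x - xi) y)%:E)%E.

Definition radon_measure (mu : {measure set (borelRn R n.-1) -> \bar R}) :=
  forall K : set 'rV[R]_n.-1, compact K -> (mu K < +oo)%E.

Definition boundary_measure (beta : R) (u : 'rV[R]_n.-1 * R -> R)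
    (mu : {measure set (borelRn R n.-1) -> \bar R}) :=
  radon_measure mu /\
  exists2 C : R, 0 <= C &
    forall x y, half_space (x, y) ->
      (u (x, y))%:E =
      ((C * y `^ (beta + rho))%:E + poisson_transform beta mu x y)%E.

Definition is_symmetric_derivative
    (mu : {measure set (borelRn R n.-1) -> \bar R})
    (x0 : 'rV[R]_n.-1) (L : R) :=
  (mu (eball x0 r) / lebesgueRn (eball x0 r : set (borelRn R n.-1)))%E
    @[r --> 0^'+] --> L%:E.

End half_space.

Arguments rho {R} n.

(* Main.v *)
Require Import Defs.
From mathcomp Require Import all_boot all_order all_algebra.
From mathcomp Require Import all_classical all_reals all_analysis.
From mathcomp Require Import measurable_realfun ring lra.

Set Implicit Arguments.
Unset Strict Implicit.
Unset Printing Implicit Defensive.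

Import Order.TTheory GRing.Theory Num.Theory.
Import numFieldNormedType.Exports.

Local Open Scope classical_set_scope.
Local Open Scope ring_scope.

(* Put [s = rho + beta], [v = |x0 - xi| ^ 2], and for [f] on [[0, 1]] and a
   measure [nu] let
     [T_nu f (t) = t ^ beta * \int (t + v) ^ (- s) f (t / (t + v)) dnu].
   Up to a constant factor and the term [C y ^ (2 beta)], which vanishes in the
   limit, [y ^ (beta - rho) u (x0, y)] is [T_mu 1 (y ^ 2)]; for Lebesgue measure
   [m], scaling makes [T_m 1] constant.  The hypothesis therefore says that
   [T_mu f - L T_m f] tends to [0] at [0+] for [f = 1].  Replacing [t] by
   [(1 + e) t] and differentiating in [e], by means of an elementary Taylor
   estimate, propagates this from [w ^ k] to [w ^ (k + 1)], hence to all
   polynomials.  As in Karamata's Tauberian theorem, polynomials close to a step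
   function then compare [mu] with [L m] on small balls.  The constants are never
   computed, since [m] itself serves as the reference measure. *)

(** * Elementary estimates *)

Section real_bounds.
Context {R : realType}.
Implicit Types a b e p t v w y : R.

Lemma bernoulli_lower y n : 0 <= y <= 1 -> 1 - n%:R * y <= (1 - y) ^+ n.
Proof.
move=> /andP[y0 y1]; elim: n => [|n IH]; first by rewrite mul0r subr0 expr0.
rewrite exprS -natr1; have n0 : 0 <= n%:R :> R by [].
have : (1 - y) * (1 - n%:R * y) <= (1 - y) * (1 - y) ^+ n.
  by rewrite ler_wpM2l// subr_ge0.
have := mulr_ge0 n0 (sqr_ge0 y); rewrite expr2; nra.
Qed.

(** Induction on [n], using [(1 - y) (1 + (n + 1) y) = 1 + n y - (n + 1) y ^ 2 <= 1 + n y]. *)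
Lemma bernoulli_upper y n : 0 <= y <= 1 -> (1 - y) ^+ n * (1 + n%:R * y) <= 1.
Proof.
move=> /andP[y0 y1]; elim: n => [|n]; first by rewrite expr0; lra.
have z0 : 0 <= (1 - y) ^+ n by rewrite exprn_ge0// subr_ge0.
rewrite exprS -natr1; move: ((1 - y) ^+ n) z0 => z z0; apply: le_trans.
rewrite [leLHS](_ : _ = z * ((1 - y) * (1 + (n%:R + 1) * y))); last ring.
apply: ler_wpM2l => //; have n0 : 0 <= n%:R :> R by [].
have := mulr_ge0 n0 (sqr_ge0 y); have := sqr_ge0 y; rewrite expr2; nra.
Qed.

(** Write the power as [expR (- p * ln (1 + y))]. The lower bound combines [1 + z <= expR z] with
    [ln (1 + y) <= y]; the upper one combines [expR (- z) <= (1 + z)^-1] with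
    [y / (1 + y) <= ln (1 + y)]. *)
Lemma powRN_taylor p y : 0 < p -> 0 <= y ->
  0 <= (1 + y) `^ (- p) - (1 - p * y) <= p * (1 + p) * y ^+ 2.
Proof.
move=> p0 y0; have y1 : 0 < 1 + y by lra.
rewrite /powR gt_eqF//; apply/andP; split.
  rewrite subr_ge0; apply: le_trans (expR_ge1Dx _).
  have : p * ln (1 + y) <= p * y by apply: ler_wpM2l; [exact: ltW|apply: le_ln1Dx; lra].
  lra.
have lny : y / (1 + y) <= ln (1 + y).
  have -> : y / (1 + y) = - ((1 + y)^-1 - 1) by field; rewrite gt_eqF.
  rewrite -[1 + y in leRHS]invrK lnV ?posrE ?invr_gt0// lerN2.
  have := @le_ln1Dx R ((1 + y)^-1 - 1).
  by rewrite [1 + (_ - 1)]addrC subrK; apply; rewrite ltrBrDr addNr invr_gt0.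
have py := mulr_ge0 (ltW p0) y0.
have z0 : 0 <= p * (y / (1 + y)).
  by apply: mulr_ge0; [exact: ltW|apply: divr_ge0; [|exact: ltW]].
have e0 : expR (- p * ln (1 + y)) <= (1 + p * (y / (1 + y)))^-1.
  rewrite mulNr expRN lef_pV2 ?posrE ?expR_gt0//; last lra.
  by apply: (le_trans _ (expR_ge1Dx _)); rewrite lerD2l; apply: ler_wpM2l; [exact: ltW|].
rewrite lerBlDr (le_trans e0)//.
have -> : (1 + p * (y / (1 + y)))^-1 = (1 + y) / (1 + y + p * y).
  by field; rewrite !gt_eqF//; lra.
rewrite ler_pdivrMr; last lra.
(* Once the denominator is cleared, all terms of order at most two in [y] cancel. *)
rewrite -subr_ge0 [leRHS](_ : _ = p * (1 + p) ^+ 2 * y ^+ 3); last ring.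
by rewrite !mulr_ge0 ?exprn_ge0//; lra.
Qed.

(* [1 - (1 - w ^ n) ^ M] is flat near [0] and near [1]; choosing [M] of order
   [b ^ -n] puts the jump between [a] and [b]. *)
Lemma polynomial_step a b e : 0 < a -> a < b -> b < 1 -> 0 < e ->
  exists q : {poly R}, forall w, 0 <= w <= 1 ->
    [/\ 0 <= q.[w] <= 1, w <= a -> q.[w] <= e & b <= w -> 1 - e <= q.[w]].
Proof.
move=> a0 ab b1 e0.
have b0 : 0 < b := lt_trans a0 ab.
have a1 : a < 1 := lt_trans ab b1.
have X0 : 0 < e^-1 by rewrite invr_gt0.
have abn : (fun n => e^-1 * (a / b) ^+ n + a ^+ n) @ \oo --> (0 : R).
  rewrite -[X in _ --> X]addr0; apply: cvgD.
    rewrite -(mulr0 e^-1); apply: cvgMl_tmp; apply: cvg_expr.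
    by rewrite ger0_norm ?divr_ge0 ?ltW// ltr_pdivrMr// mul1r.
  by apply: cvg_expr; rewrite ger0_norm ?ltW.
have [n [n0 hn]] : exists n, (0 < n)%N /\ e^-1 * (a / b) ^+ n + a ^+ n <= e.
  have [N _ hN] : \forall n \near \oo, e^-1 * (a / b) ^+ n + a ^+ n <= e.
    by apply: (cvgr_le _ abn); lra.
  by exists N.+1; split => //; exact/hN/leqnSn.
(* For [w >= b], [M b ^ n > e^-1] and [bernoulli_upper] give [(1 - w ^ n) ^ M <= e]. For [w <= a],
   [bernoulli_lower] gives [q.[w] <= M w ^ n], and [M a ^ n <= (e^-1 / b ^ n + 1) a ^ n <= e] by the
   choice of [n]. *)
pose M := (Num.truncn (e^-1 / b ^+ n)).+1.
have bn0 : 0 < b ^+ n by rewrite exprn_gt0.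
have /andP[M2 M1] : M%:R - 1 <= e^-1 / b ^+ n < M%:R.
  rewrite mulrSr addrK -mulrSr; apply: truncn_itv.
  by rewrite divr_ge0 ?ltW// invr_ge0 ltW.
rewrite ltr_pdivrMr// in M1.
exists (1 - (1 - 'X^n) ^+ M) => w /andP[w0 w1].
rewrite hornerD hornerN horner_exp !hornerE.
have wn0 : 0 <= w ^+ n by rewrite exprn_ge0.
have wn1 : w ^+ n <= 1 by rewrite exprn_ile1.
have z0 : 0 <= (1 - w ^+ n) ^+ M by rewrite exprn_ge0// subr_ge0.
have z1 : (1 - w ^+ n) ^+ M <= 1 by rewrite exprn_ile1//; lra.
split; first by lra.
- move=> wa.
  have wan : w ^+ n <= a ^+ n by rewrite lerXn2r// nnegrE ltW.
  have an : e^-1 * (a / b) ^+ n + a ^+ n = (e^-1 / b ^+ n + 1) * a ^+ n.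
    by rewrite expr_div_n; field; rewrite !gt_eqF.
  have := @bernoulli_lower (w ^+ n) M; rewrite wn0 wn1 => /(_ isT).
  have : M%:R * w ^+ n <= (e^-1 / b ^+ n + 1) * a ^+ n.
    by apply: ler_pM => //; lra.
  lra.
- move=> bw.
  have bwn : b ^+ n <= w ^+ n by rewrite lerXn2r// nnegrE ltW.
  have := @bernoulli_upper (w ^+ n) M; rewrite wn0 wn1 => /(_ isT).
  move: ((1 - w ^+ n) ^+ M) z0 => z z0 hz.
  suff : z * e^-1 <= 1 by rewrite ler_pdivrMr// mul1r; lra.
  apply: le_trans hz; apply: ler_wpM2l => //.
  have : M%:R * b ^+ n <= M%:R * w ^+ n by rewrite ler_wpM2l.
  lra.
Qed.

End real_bounds.

(** * The generalized Stieltjes transform *)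

Definition stieltjes_kernel (R : realType) (beta s t v : R) : R :=
  t `^ beta * (t + v) `^ (- s).

(** The space and the function [v] stay abstract so that the boundary measure and Lebesgue measure
    are treated alike. The integral is real-valued, hence the integrability conditions in its
    linearity and monotonicity. *)
Definition stieltjes (R : realType) (beta s : R) d (T : measurableType d)
    (nu : {measure set T -> \bar R}) (v : T -> R) (f : R -> R) (t : R) : R :=
  \int[nu]_x (stieltjes_kernel beta s t (v x) * f (t / (t + v x))).

(** A bound on [[0, 1]] suffices because [t / (t + v)] lies there, and it admits all polynomials. *)
Definition bounded_measurable01 (R : realType) (f : R -> R) :=
  measurable_fun setT f /\ exists c, forall w, 0 <= w <= 1 -> `|f w| <= c.

Lemma bounded_measurable01_horner (R : realType) (q : {poly R}) :
  bounded_measurable01 (horner q).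
Proof.
split.
  apply: continuous_measurable_fun => x; exact: continuous_horner.
exists (\sum_(i < size q) `|q`_i|) => w /andP[w0 w1].
rewrite horner_coef (le_trans (ler_norm_sum _ _ _))// ler_sum// => i _.
by rewrite normrM ler_piMr// normrX exprn_ile1// ger0_norm.
Qed.

Lemma bounded_measurable01_exp (R : realType) k :
  bounded_measurable01 (fun w : R => w ^+ k).
Proof.
rewrite (_ : (fun w => _) = horner 'X^k); first exact: bounded_measurable01_horner.
by apply/funext => w; rewrite hornerXn.
Qed.

Lemma measurable_sublevel (R : realType) d (T : measurableType d) (v : T -> R)
    (r : R) : measurable_fun setT v -> measurable [set x | v x < r].
Proof.
move=> mv; rewrite (_ : [set _ | _] = v @^-1` `]-oo, r[%classic).
  by rewrite -[X in measurable X]setTI; apply: mv => //; exact: measurable_itv.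
by apply/seteqP; split => x /=; rewrite in_itv.
Qed.

Lemma measurable_stieltjes_kernel (R : realType) (beta s t : R) d
    (T : measurableType d) (v : T -> R) : measurable_fun setT v ->
  measurable_fun setT (fun x => stieltjes_kernel beta s t (v x)).
Proof.
move=> mv; apply: measurable_funM => //.
rewrite (_ : (fun x => _) = (@powR R)^~ (- s) \o (fun x => t + v x))//.
by apply: measurableT_comp; [exact: measurable_powR|exact: measurable_funD].
Qed.

Section stieltjes.
Context (R : realType) (beta s : R) d (T : measurableType d).
Variables (nu : {measure set T -> \bar R}) (v : T -> R).
Hypotheses (mv : measurable_fun setT v) (v_ge0 : forall x, 0 <= v x).
Hypothesis iK : forall t : R, 0 < t ->
  nu.-integrable setT (EFin \o (fun x => stieltjes_kernel beta s t (v x))).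
Implicit Types (f g : R -> R) (t c e r : R).
Local Notation K := (stieltjes_kernel beta s).
Local Notation S := (stieltjes beta s nu v).

Lemma stieltjes_kernel_ge0 t y : 0 <= K t y.
Proof. by rewrite mulr_ge0 ?powR_ge0. Qed.

Lemma stieltjes_arg01 t x : 0 < t -> 0 <= t / (t + v x) <= 1.
Proof.
move=> t0; have tv : 0 < t + v x by rewrite ltr_pwDl.
by rewrite divr_ge0 ?(ltW t0) ?(ltW tv)//= ler_pdivrMr// mul1r lerDl.
Qed.

Lemma integrable_stieltjes f t : bounded_measurable01 f -> 0 < t ->
  nu.-integrable setT (EFin \o (fun x => K t (v x) * f (t / (t + v x)))).
Proof.
move=> [mf [c fc]] t0; have mK := measurable_int _ (iK t0).
have iKc := integrableZl measurableT c (iK t0).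
apply: le_integrable iKc => //.
  apply/measurable_EFinP/measurable_funM; first exact/measurable_EFinP.
  apply: measurableT_comp => //; apply: measurable_funM => //.
  rewrite (_ : (fun x => _) = (@powR R)^~ (-1) \o (fun x => t + v x)).
    by apply: measurableT_comp; [exact: measurable_powR|exact: measurable_funD].
  apply/funext => x /=; rewrite powR_inv1//.
  by rewrite ltW// ltr_pwDl.
move=> x _; rewrite lee_fin !normrM mulrC; apply: ler_pM => //.
by apply: (le_trans _ (ler_norm c)); apply/fc/stieltjes_arg01.
Qed.

Lemma stieltjesD f g t : bounded_measurable01 f -> bounded_measurable01 g ->
  0 < t -> S (f \+ g) t = S f t + S g t.
Proof.
move=> bf bg t0; rewrite /stieltjes -RintegralD//; [|exact: integrable_stieltjes..].
by apply: eq_Rintegral => x _; rewrite mulrDr.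
Qed.

Lemma stieltjesZ c f t : bounded_measurable01 f -> 0 < t ->
  S (c \*o f) t = c * S f t.
Proof.
move=> bf t0; rewrite /stieltjes -RintegralZl//; last exact: integrable_stieltjes.
by apply: eq_Rintegral => x _; rewrite mulrCA.
Qed.

Lemma le_stieltjes f g t :
  bounded_measurable01 f -> bounded_measurable01 g -> 0 < t ->
  (forall w, 0 <= w <= 1 -> f w <= g w) -> S f t <= S g t.
Proof.
move=> bf bg t0 fg; apply: le_Rintegral => //; [exact: integrable_stieltjes..|].
move=> x _; apply: ler_wpM2l; first exact: stieltjes_kernel_ge0.
exact/fg/stieltjes_arg01.
Qed.

Lemma stieltjes_ge0 f t : 0 < t -> (forall w, 0 <= w <= 1 -> 0 <= f w) ->
  0 <= S f t.
Proof.
move=> t0 f0; apply: Rintegral_ge0 => x _.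
by rewrite mulr_ge0 ?stieltjes_kernel_ge0// f0// stieltjes_arg01.
Qed.

(** With [w = t / (t + v)] one has [(1 + e) t + v = (t + v) (1 + e w)], so dilating [t] replaces the
    argument [w] by [(1 + e) w / (1 + e w)]. *)
Lemma stieltjes_scale (k : nat) e t : 0 <= e -> 0 < t ->
  S (fun w => w ^+ k * (1 + e * w) `^ (- (s + k%:R))) t =
  (1 + e) `^ (- (beta + k%:R)) * S (fun w => w ^+ k) ((1 + e) * t).
Proof.
move=> e0 t0; have e1 : 0 < 1 + e by rewrite ltr_pwDl.
rewrite /stieltjes -RintegralZl//; last first.
  apply: (integrable_stieltjes (f := fun w => w ^+ k)) => //; last exact: mulr_gt0.
  exact: bounded_measurable01_exp.
apply: eq_Rintegral => x _; rewrite /stieltjes_kernel.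
set tau := t + v x; have tau0 : 0 < tau by rewrite ltr_pwDl.
set w := t / tau; have w0 : 0 <= w by rewrite divr_ge0 ?ltW.
have ew : 0 < 1 + e * w by rewrite ltr_pwDl// mulr_ge0.
have -> : (1 + e) * t + v x = tau * (1 + e * w).
  by rewrite /w /tau; field; rewrite gt_eqF.
rewrite (powRM _ (ltW e1) (ltW t0)) (powRM _ (ltW tau0) (ltW ew)).
have pN a b : 0 < a -> a `^ (- (b + k%:R)) = (a `^ b)^-1 * (a ^+ k)^-1.
  move=> a0; rewrite powRN powRD ?(gt_eqF a0) ?implybT// powR_mulrn ?ltW// invfM//.
rewrite !pN// !powRN.
have -> : (1 + e) * t / (tau * (1 + e * w)) = (1 + e) * w / (1 + e * w).
  by rewrite invfM /w !mulrA.
clearbody w tau; rewrite expr_div_n exprMn.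
have := exprn_gt0 k e1; have := exprn_gt0 k ew; have := powR_gt0 beta e1.
have := powR_gt0 s tau0; have := powR_gt0 s ew.
move: (w ^+ k) ((1 + e) ^+ k) ((1 + e * w) ^+ k) ((1 + e) `^ beta) => *.
by field; rewrite !gt_eqF.
Qed.

Let mS r : measurable [set x | v x < r] := measurable_sublevel r mv.

Hypothesis s_gt0 : 0 < s.

Let kernel_lower t r x : 0 < t -> v x < r * t ->
  (1 + r) `^ (- s) * t `^ (beta - s) <= K t (v x).
Proof.
move=> t0 vr; rewrite /stieltjes_kernel.
(* Positivity is forced by [0 <= v x < r * t]. *)
have r0 : 0 < 1 + r.
  rewrite -(pmulr_lgt0 _ t0) mulrDl mul1r.
  by rewrite (lt_trans _ (ler_ltD (lexx t) vr))// ltr_pwDl.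
rewrite powRB ?(gt_eqF t0) ?implybT// mulrCA -powRN -(powRM _ (ltW r0) (ltW t0)).
apply: ler_wpM2l; first exact: powR_ge0.
have tv : 0 < t + v x by rewrite ltr_pwDl.
have rt : 0 < (1 + r) * t by rewrite mulr_gt0.
rewrite !powRN lef_pV2 ?posrE ?powR_gt0//.
apply: ge0_ler_powR; rewrite ?nnegrE; [exact: ltW..|].
by rewrite mulrDl mul1r lerD2l ltW.
Qed.

(** On this set the kernel at [t = r] is at least the positive number [k], by [kernel_lower] with
    ratio [1]; a multiple of the kernel therefore dominates the constant. *)
Lemma integrable_cst_sublevel r c : 0 < r ->
  nu.-integrable [set x | v x < r] (EFin \o cst c).
Proof.
move=> r0; pose k := 2 `^ (- s) * r `^ (beta - s).
have k0 : 0 < k by rewrite mulr_gt0 ?powR_gt0.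
have := integrableS measurableT (mS r) (@subsetT _ _) (iK r0).
move=> /(integrableZl (mS r) (c / k)).
apply: le_integrable => //=.
  exact/measurable_EFinP.
move=> x /= vr; rewrite lee_fin normrM.
have := @kernel_lower r 1 x r0; rewrite mul1r => /(_ vr) kK.
rewrite [X in _ * X]ger0_norm ?stieltjes_kernel_ge0//.
rewrite normrM normfV (gtr0_norm k0) -mulrA ler_peMr// mulrC ler_pdivlMr// mul1r.
exact: kK.
Qed.

Lemma sublevel_lty r : 0 < r -> (nu [set x | (v x < r)%R] < +oo)%E.
Proof.
move=> r0; have /integrable_lty := integrable_cst_sublevel 1 r0.
by move=> /(_ (mS r)); rewrite (integral_cst _ _ 1%:E)// mul1e.
Qed.

Let restrict_sublevel_integral r c : 0 < r ->
  nu.-integrable setT (EFin \o (cst c \_ [set x | v x < r])) /\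
  \int[nu]_x ((cst c \_ [set x | v x < r]) x) = c * fine (nu [set x | v x < r]).
Proof.
move=> r0; split; last by rewrite -Rintegral_mkcond Rintegral_cst.
have := integrable_cst_sublevel c r0.
by rewrite integrable_mkcond// restrict_EFin.
Qed.

(** Where [v < r t], the argument [t / (t + v)] exceeds [(1 + r)^-1] and [kernel_lower] applies;
    elsewhere the integrand is nonnegative. *)
Lemma stieltjes_ge_measure f t r c : bounded_measurable01 f ->
  0 < t -> 0 < r -> 0 <= c -> (forall w, 0 <= w <= 1 -> 0 <= f w) ->
  (forall w, (1 + r)^-1 <= w <= 1 -> c <= f w) ->
  c * ((1 + r) `^ (- s) * t `^ (beta - s)) *
    fine (nu [set x | v x < r * t]) <= S f t.
Proof.
move=> bf t0 r0 c0 f0 fc; have rt0 : 0 < r * t by rewrite mulr_gt0.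
set k := (1 + r) `^ _ * _.
have [iD <-] := restrict_sublevel_integral (c * k) rt0.
apply: le_Rintegral => //; first exact: integrable_stieltjes.
move=> x _; rewrite patchE; case: ifPn => [|_]; last first.
  by rewrite mulr_ge0 ?stieltjes_kernel_ge0// f0// stieltjes_arg01.
rewrite inE /= => vr; rewrite mulrC; apply: ler_pM => //.
- by rewrite mulr_ge0 ?powR_ge0.
- exact: kernel_lower.
have /andP[_ w1] := stieltjes_arg01 x t0.
apply: fc; rewrite w1 andbT; have tv : 0 < t + v x by rewrite ltr_pwDl.
rewrite ler_pdivlMr// mulrC ler_pdivrMr ?addr_gt0//; lra.
Qed.

(** Where [v < r t], use [f <= 1] and bound the kernel by its value [t ^ (beta - s)] at [v = 0];
    elsewhere the argument is at most [(1 + r)^-1], so [f <= c]. *)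
Lemma stieltjes_le_measure f t r c : bounded_measurable01 f ->
  0 < t -> 0 < r -> 0 <= c -> (forall w, 0 <= w <= 1 -> 0 <= f w <= 1) ->
  (forall w, 0 <= w <= (1 + r)^-1 -> f w <= c) ->
  S f t <= t `^ (beta - s) * fine (nu [set x | v x < r * t]) + c * S (cst 1) t.
Proof.
move=> bf t0 r0 c0 f1 fc; have rt0 : 0 < r * t by rewrite mulr_gt0.
have b1 : bounded_measurable01 (cst 1 : R -> R).
  by split => //; exists 1 => w _; rewrite normr1.
have [iD <-] := restrict_sublevel_integral (t `^ (beta - s)) rt0.
have i1 := integrable_stieltjes b1 t0.
have ic := integrableZl measurableT c i1.
rewrite /stieltjes -RintegralZl// -RintegralD//.
apply: le_Rintegral => //; [exact: integrable_stieltjes| |].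
  exact: (integrableD measurableT iD ic).
move=> x _; have w01 := stieltjes_arg01 x t0.
have /andP[f0 fle1] := f1 _ w01; have K0 := stieltjes_kernel_ge0 t (v x).
rewrite /= mulr1 patchE; case: ifPn => [_|].
  apply: (@le_trans _ _ (K t (v x))); first by rewrite ler_piMr.
  apply: (@le_trans _ _ (t `^ (beta - s))); last by rewrite lerDl mulr_ge0.
  rewrite powRB ?(gt_eqF t0) ?implybT// -powRN; apply: ler_wpM2l; first exact: powR_ge0.
  have tv : 0 < t + v x by rewrite ltr_pwDl.
  rewrite !powRN lef_pV2 ?posrE ?powR_gt0//.
  by apply: ge0_ler_powR; rewrite ?nnegrE ?lerDl//; exact: ltW.
rewrite notin_setE /= => /negP; rewrite -leNgt => vr.
rewrite add0r mulrC; apply: ler_wpM2r => //; apply: fc.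
case/andP: w01 => -> _ /=; have tv : 0 < t + v x by rewrite ltr_pwDl.
rewrite ler_pdivrMr// mulrC ler_pdivlMr ?addr_gt0//; lra.
Qed.

End stieltjes.

(** * A Tauberian comparison theorem *)

Section near_zero.
Context {R : realType}.

Lemma near_right0P (P : R -> Prop) :
  (\forall t \near 0^'+, P t) <-> exists2 d, 0 < d & forall t, 0 < t < d -> P t.
Proof.
split=> [[d /= d0 dP]|[d d0 dP]].
  exists d => // t /andP[t0 td]; apply: dP => //=.
  by rewrite /ball_ sub0r normrN gtr0_norm.
by exists d => //= t; rewrite /ball_/= sub0r normrN => td t0; apply: dP;
  rewrite t0 -(gtr0_norm t0).
Qed.

Lemma near_right0_scale (k : R) (P : R -> Prop) : 0 < k ->
  (\forall t \near 0^'+, P t) -> \forall t \near 0^'+, P (k * t).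
Proof.
move=> k0 /near_right0P[d d0 dP]; apply/near_right0P.
exists (d / k); first by rewrite divr_gt0.
move=> t /andP[t0 tk]; apply: dP; rewrite mulr_gt0//=.
by rewrite mulrC -ltr_pdivlMr.
Qed.

(** Serves to rewrite a limit in the height [y] as a limit in [t = y ^ 2]. *)
Lemma sqrt_cvg_right0 : Num.sqrt t @[t --> (0 : R)^'+] --> (0 : R)^'+.
Proof.
move=> P /near_right0P[d d0 dP]; apply/near_right0P.
exists (d ^+ 2); first by rewrite exprn_gt0.
move=> t /andP[t0 td]; apply: dP; rewrite sqrtr_gt0 t0/=.
by rewrite -(ltr_pXn2r (ltn0Sn 1)) ?nnegrE ?sqrtr_ge0 ?(ltW d0)// sqr_sqrtr ?ltW.
Qed.

(** Serves to rewrite a limit in the level of a squared distance as a limit in the radius. *)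
Lemma sqr_cvg_right0 : t ^+ 2 @[t --> (0 : R)^'+] --> (0 : R)^'+.
Proof.
move=> P /near_right0P[d d0 dP]; apply/near_right0P.
exists (Num.sqrt d); first by rewrite sqrtr_gt0.
move=> t /andP[t0 td]; apply: dP; rewrite exprn_gt0//=.
by rewrite -(sqr_sqrtr (ltW d0)) ltrXn2r// ?ltW.
Qed.

Lemma small_pos (x y : R) : 0 < x -> exists2 e, 0 < e < 1 & e * y <= x.
Proof.
move=> x0; exists (Num.min 2^-1 (x / (`|y| + 1))).
  rewrite lt_min gt_min invr_gt0 ltr0n/= divr_gt0 ?ltr_wpDl//=.
  by apply/orP; left; lra.
have y1 : 0 < `|y| + 1 by rewrite ltr_wpDl.
have e0 : 0 <= Num.min 2^-1 (x / (`|y| + 1)).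
  by rewrite le_min invr_ge0 ler0n/= divr_ge0 ?ltW.
apply: (@le_trans _ _ (x / (`|y| + 1) * (`|y| + 1))); last by rewrite divfK ?gt_eqF.
apply: (@le_trans _ _ (Num.min 2^-1 (x / (`|y| + 1)) * (`|y| + 1))).
  by apply: ler_wpM2l => //; have := ler_norm y; lra.
by apply: ler_wpM2r; [exact: ltW|rewrite ge_min lexx orbT].
Qed.

End near_zero.

Lemma bounded_measurable01D (R : realType) (f g : R -> R) :
  bounded_measurable01 f -> bounded_measurable01 g ->
  bounded_measurable01 (f \+ g).
Proof.
move=> [mf [a fa]] [mg [b gb]]; split; first exact: measurable_funD.
by exists (a + b) => w w01; rewrite (le_trans (ler_normD _ _))// lerD ?fa ?gb.
Qed.

Lemma bounded_measurable01Z (R : realType) (a : R) (f : R -> R) :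
  bounded_measurable01 f -> bounded_measurable01 (a \*o f).
Proof.
move=> [mf [b fb]]; split; first exact: measurable_funM.
by exists (`|a| * b) => w w01; rewrite normrM ler_wpM2l// fb.
Qed.

Lemma bounded_measurable01_dilation (R : realType) (k : nat) (e p : R) :
  0 <= e -> 0 < p ->
  bounded_measurable01 (fun w => w ^+ k * (1 + e * w) `^ (- p)).
Proof.
move=> e0 p0; split.
  apply: measurable_funM; first exact: (bounded_measurable01_exp R k).1.
  rewrite (_ : (fun w => _) = (@powR R)^~ (- p) \o (fun w => 1 + e * w))//.
  apply: measurableT_comp; first exact: measurable_powR.
  by apply: measurable_funD => //; exact: measurable_funM.
exists 1 => w /andP[w0 w1]; have ew : 0 <= e * w by rewrite mulr_ge0.
rewrite normrM -[leRHS]mulr1; apply: ler_pM => //.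
  by rewrite normrX exprn_ile1// ger0_norm.
rewrite ger0_norm ?powR_ge0// -[leRHS](powRr0 (1 + e * w)); apply: ler_powR; lra.
Qed.

(** The factor [a] may cost [3 / 4 * e] and the error [y] the remaining quarter. If [x > z + e],
    then [(1 - k) x > (z + e) - 3 / 4 * e >= z + y], against the first inequality; the other
    direction is linear. *)
Lemma almost_equal (R : realType) (x z e a k y : R) :
  0 <= x -> 0 <= z -> 0 < e -> 0 <= k -> 1 - k <= a ->
  (z + e) * k <= 3 / 4 * e -> y <= e / 4 ->
  a * x <= z + y -> a * z <= x + y -> `|z - x| <= e.
Proof.
move=> x0 z0 e0 k0 ka zk ye ax az; have ze : 0 < z + e by rewrite ltr_wpDl.
have k1 : 0 < 1 - k by rewrite subr_gt0 -(ltr_pM2l ze); lra.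
have := ler_wpM2r x0 ka; have := ler_wpM2r z0 ka; have := mulr_ge0 (ltW e0) k0.
move=> ek az' ax'; rewrite ler_norml; apply/andP; split; last lra.
rewrite lerNl opprB lerBlDl leNgt; apply/negP => xz.
by move: xz; rewrite -(ltr_pM2l k1); lra.
Qed.

(** * Comparison of two transforms for power and polynomial weights *)

Section tauberian.
Context (R : realType) (beta s : R) (s_gt0 : 0 < s).
Context d1 (T1 : measurableType d1) (mu : {measure set T1 -> \bar R}).
Context d2 (T2 : measurableType d2) (nu : {measure set T2 -> \bar R}).
Variables (v1 : T1 -> R) (v2 : T2 -> R).
Hypotheses (mv1 : measurable_fun setT v1) (v1_ge0 : forall x, 0 <= v1 x).
Hypotheses (mv2 : measurable_fun setT v2) (v2_ge0 : forall x, 0 <= v2 x).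
Hypothesis iK1 : forall t : R, 0 < t ->
  mu.-integrable setT (EFin \o (fun x => stieltjes_kernel beta s t (v1 x))).
Hypothesis iK2 : forall t : R, 0 < t ->
  nu.-integrable setT (EFin \o (fun x => stieltjes_kernel beta s t (v2 x))).
Variables (c L : R) (L_ge0 : 0 <= L).
Hypothesis nu1 : forall t, 0 < t -> stieltjes beta s nu v2 (cst 1) t = c.
Hypothesis mu1 : stieltjes beta s mu v1 (cst 1) t @[t --> 0^'+] --> L * c.
Local Notation S1 := (stieltjes beta s mu v1).
Local Notation S2 := (stieltjes beta s nu v2).
Local Notation D f t := (S1 f t - L * S2 f t).

Let c_ge0 : 0 <= c.
Proof. by rewrite -(nu1 ltr01); apply: stieltjes_ge0. Qed.

Let D_add f g t : bounded_measurable01 f -> bounded_measurable01 g -> 0 < t ->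
  D (f \+ g) t = D f t + D g t.
Proof. by move=> *; rewrite !stieltjesD//; lra. Qed.

Let D_scale a f t : bounded_measurable01 f -> 0 < t ->
  D (a \*o f) t = a * D f t.
Proof. by move=> *; rewrite !stieltjesZ//; lra. Qed.

Let b1 : bounded_measurable01 (cst 1 : R -> R).
Proof. by split => //; exists 1 => w _; rewrite normr1. Qed.

Let S1_bounded : \forall t \near 0^'+, S1 (cst 1) t <= L * c + 1.
Proof. by apply: (cvgr_le _ mu1); rewrite ltrDl. Qed.

Let D_cst : D (cst 1) t @[t --> 0^'+] --> 0.
Proof.
rewrite -[X in _ --> X](subrr (L * c)); apply: cvgB => //.
apply: cvg_near_cst; near=> t; rewrite nu1//; near: t; exact: nbhs_right_gt.
Unshelve. all: by end_near.
Qed.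

(** Both transforms of [f] are nonnegative and at most [a] times those of [1], so their difference
    is bounded by the sum. This crude bound is enough for a Taylor remainder, whose [a] is
    quadratically small. *)
Let D_le f a t : bounded_measurable01 f -> 0 < t ->
  (forall w, 0 <= w <= 1 -> 0 <= f w <= a) ->
  `|D f t| <= a * (S1 (cst 1) t + L * c).
Proof.
move=> bf t0 fa; have ba := bounded_measurable01Z a b1.
have f0 w : 0 <= w <= 1 -> 0 <= f w by move=> /fa/andP[].
have S1f0 : 0 <= S1 f t by apply: stieltjes_ge0.
have S2f0 : 0 <= L * S2 f t by rewrite mulr_ge0//; apply: stieltjes_ge0.
have fa' w : 0 <= w <= 1 -> f w <= (a \*o cst 1) w.
  by move=> /fa/andP[_]; rewrite /= mulr1.
have := @le_stieltjes _ beta s _ _ _ _ mv1 v1_ge0 iK1 _ _ _ bf ba t0 fa'.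
have := @le_stieltjes _ beta s _ _ _ _ mv2 v2_ge0 iK2 _ _ _ bf ba t0 fa'.
rewrite !stieltjesZ// (nu1 t0) => /(ler_wpM2l L_ge0) S2f S1f.
by rewrite ler_norml; apply/andP; split; lra.
Qed.

(* With [p = s + k], the dilation [t -> (1 + e) t] turns the weight [w ^ k]
   into [w ^ k (1 + e w) ^ -p], whose derivative in [e] at [0] is
   [- p w ^ (k + 1)]. *)
Lemma stieltjes_exp_cvg (k : nat) :
  D (fun w => w ^+ k) t @[t --> 0^'+] --> 0.
Proof.
elim: k => [|k IH].
  by rewrite (_ : (fun w => w ^+ 0) = cst 1)//; apply/funext => w; rewrite expr0.
apply/cvgr0Pnorm_le => eta eta0.
pose p := s + k%:R; have p0 : 0 < p by rewrite ltr_pwDl.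
pose B := L * c + 1 + L * c; have B0 : 0 < B.
  by have := mulr_ge0 L_ge0 c_ge0; rewrite /B; lra.
(* The remainder will contribute at most [p (1 + p) e ^ 2 B <= e * (p * eta / 2)], and the two known
   differences at most [d = e * p * eta / 4] each; the total is [p * e * eta], and [p * e] is the
   coefficient of the unknown difference. *)
have [e /andP[e0 e1] eB] := @small_pos R (p * eta / 2) (p * (1 + p) * B)
  ltac:(by rewrite divr_gt0 ?mulr_gt0).
have e10 : 0 < 1 + e by rewrite ltr_pwDl// ltW.
pose d := e * p * eta / 4; have d0 : 0 < d by rewrite divr_gt0 ?mulr_gt0.
have d0' : 0 < d * (1 + e) `^ (beta + k%:R) by rewrite mulr_gt0 ?powR_gt0.
move/cvgr0Pnorm_le : IH => IH; have IH0 := IH _ d0.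
(* The induction hypothesis is also needed at [(1 + e) t], with a tolerance that offsets the factor
   produced by [stieltjes_scale]. *)
have IH1 := near_right0_scale e10 (IH _ d0').
near=> t; have t0 : 0 < t by near: t; exact: nbhs_right_gt.
pose g w := w ^+ k * (1 + e * w) `^ (- p).
have bg : bounded_measurable01 g.
  by apply: bounded_measurable01_dilation => //; exact: ltW.
have bk i := bounded_measurable01_exp R i.
have Dg : `|D g t| <= d.
  rewrite !stieltjes_scale ?(ltW e0)// mulrCA -mulrBr normrM powRN.
  rewrite ger0_norm ?invr_ge0 ?powR_ge0// mulrC ler_pdivrMr ?powR_gt0//.
  by near: t.
have Dk : `|D (fun w => w ^+ k) t| <= d by near: t.
(* The Taylor remainder [w ^ k ((1 + e w) ^ (- p) - 1 + p e w)], split into weights whose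
   differences are known or sought. *)
pose h := (p * e \*o (fun w => w ^+ k.+1)) \+ ((-1 \*o (fun w => w ^+ k)) \+ g).
have bh1 := bounded_measurable01Z (p * e) (bk k.+1).
have bh2 := bounded_measurable01Z (-1) (bk k).
have bh3 := bounded_measurable01D bh2 bg.
have bh : bounded_measurable01 h := bounded_measurable01D bh1 bh3.
have h01 w : 0 <= w <= 1 -> 0 <= h w <= p * (1 + p) * e ^+ 2.
  move=> /andP[w0 w1]; have ew : 0 <= e * w by rewrite mulr_ge0// ltW.
  have -> : h w = w ^+ k * ((1 + e * w) `^ (- p) - (1 - p * (e * w))).
    by rewrite /h/g /= exprS; ring.
  have /andP[r0 r1] := powRN_taylor p0 ew.
  have wk : 0 <= w ^+ k <= 1 by rewrite exprn_ge0// exprn_ile1.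
  case/andP: wk => wk0 wk1; rewrite mulr_ge0//= -[leRHS]mul1r.
  apply: ler_pM => //; apply: (le_trans r1); apply: ler_wpM2l.
    by rewrite mulr_ge0 ?ltW// ltr_pwDl// ltW.
  by rewrite exprMn ler_piMr ?exprn_ge0 ?exprn_ile1// ltW.
have := D_le bh t0 h01.
have -> : D h t = p * e * D (fun w => w ^+ k.+1) t - D (fun w => w ^+ k) t + D g t.
  by rewrite (D_add bh1 bh3 t0) (D_add bh2 bg t0) !D_scale//; lra.
have S1B : S1 (cst 1) t <= L * c + 1 by near: t.
set X := D (fun w => w ^+ k.+1) t; set Y := D _ t in Dk *; set Z := D g t in Dg *.
have pe : 0 < p * e by rewrite mulr_gt0.
move=> hXYZ; rewrite -(ler_pM2l pe).
have -> : p * e * `|X| = `|p * e * X| by rewrite normrM (gtr0_norm pe).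
have -> : p * e * X = p * e * X - Y + Z + (Y - Z) by ring.
apply: (le_trans (ler_normD _ _)); have := ler_normB Y Z.
have : p * (1 + p) * e ^+ 2 * (S1 (cst 1) t + L * c) <= e * (p * eta / 2).
  apply: le_trans (_ : e * (e * (p * (1 + p) * B)) <= _); last by rewrite ler_pM2l.
  rewrite [leRHS](_ : _ = p * (1 + p) * e ^+ 2 * B); last ring.
  by rewrite ler_pM2l ?mulr_gt0 ?exprn_gt0 ?ltr_pwDl ?lerD2r// ltW.
move: hXYZ Dg Dk; rewrite /d; lra.
Unshelve. all: by end_near. Qed.

Lemma stieltjes_horner_cvg (q : {poly R}) :
  D (horner q) t @[t --> 0^'+] --> 0.
Proof.
pose f n w := \sum_(i < n) q`_i * w ^+ i.
have fS n : f n.+1 = f n \+ (q`_n \*o (fun w => w ^+ n)).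
  by apply/funext => w; rewrite /f big_ord_recr.
have bX n := bounded_measurable01Z q`_n (bounded_measurable01_exp R n).
have bf n : bounded_measurable01 (f n).
  elim: n => [|n IH]; last by rewrite fS; exact: bounded_measurable01D.
  have -> : f 0%N = 0 \*o cst 1 by apply/funext => w; rewrite /f big_ord0 /= mul0r.
  exact: bounded_measurable01Z.
suff Df n : D (f n) t @[t --> 0^'+] --> 0.
  rewrite (_ : horner q = f (size q))//.
  by apply/funext => w; rewrite horner_coef.
elim: n => [|n IH].
  apply: cvg_near_cst; near=> t.
  have -> : f 0%N = 0 \*o cst 1 by apply/funext => w; rewrite /f big_ord0 /= mul0r.
  by rewrite D_scale ?mul0r//; near: t; exact: nbhs_right_gt.
rewrite fS.
have : D (f n) t + q`_n * D (fun w => w ^+ n) t @[t --> 0^'+] --> 0 + q`_n * 0.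
  by apply: cvgD => //; apply: cvgMl_tmp; exact: stieltjes_exp_cvg.
rewrite mulr0 addr0; apply: cvg_trans; apply: near_eq_cvg; near=> t.
have t0 : 0 < t by near: t; exact: nbhs_right_gt.
rewrite (D_add (bf n) (bX n) t0) D_scale//; exact: bounded_measurable01_exp.
Unshelve. all: by end_near. Qed.

(** * From polynomial weights to the measure of sublevel sets *)

Hypothesis beta_le_s : beta <= s.
Variable M : R.
Hypothesis nu_sublevel : forall r : R, 0 < r ->
  fine (nu [set x | v2 x < r]) = M * r `^ (s - beta).
Local Notation phi r := (r `^ (beta - s) * fine (mu [set x | v1 x < r])).

Let M_ge0 : 0 <= M.
Proof.
have := nu_sublevel ltr01; rewrite powR1 mulr1 => <-.
by rewrite fine_ge0.
Qed.

(* Both bounds sandwich a polynomial that is nearly [1] on [v < eta t] and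
   nearly [0] off [v < eta (1 + eta) t]. *)
Let sublevel_sandwich eta eps : 0 < eta -> 0 < eps < 1 ->
  \forall t \near 0^'+,
    (1 - eps) * ((1 + eta) `^ (- s) * t `^ (beta - s)) *
      fine (mu [set x | v1 x < eta * t]) <=
      L * (M * (eta * (1 + eta)) `^ (s - beta)) + eps * (L * c + 2) /\
    L * ((1 - eps) * ((1 + eta) `^ (- s) * (M * eta `^ (s - beta)))) <=
      t `^ (beta - s) * fine (mu [set x | v1 x < eta * (1 + eta) * t]) +
      eps * (L * c + 2).
Proof.
move=> eta0 /andP[eps0 eps1].
have eta1 : 0 < 1 + eta by rewrite addr_gt0.
have eta'0 : 0 < eta * (1 + eta) by rewrite mulr_gt0.
(* For [w = t / (t + v)], the thresholds [(1 + eta)^-1] and [(1 + eta * (1 + eta))^-1] correspond to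
   [v = eta t] and [v = eta (1 + eta) t]. *)
have [q qP] : exists q : {poly R}, forall w, 0 <= w <= 1 ->
    [/\ 0 <= q.[w] <= 1, w <= (1 + eta * (1 + eta))^-1 -> q.[w] <= eps &
        (1 + eta)^-1 <= w -> 1 - eps <= q.[w]].
  apply: polynomial_step => //.
  - by rewrite invr_gt0 addr_gt0.
  - by rewrite ltf_pV2 ?posrE ?addr_gt0// ltrD2l ltr_pMr// ltrDl.
  - by rewrite invf_lt1// ltrDl.
have bq := bounded_measurable01_horner q.
have q1 w : 0 <= w <= 1 -> 0 <= q.[w] <= 1 by move=> /qP[].
have q0 w : 0 <= w <= 1 -> 0 <= q.[w] by move=> /q1/andP[].
have qb w : (1 + eta)^-1 <= w <= 1 -> 1 - eps <= q.[w].
  move=> /andP[bw w1]; have w0 : 0 <= w by rewrite (le_trans _ bw)// invr_ge0 ltW.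
  by have [//|_ _] := qP w; [rewrite w0|apply].
have qa w : 0 <= w <= (1 + eta * (1 + eta))^-1 -> q.[w] <= eps.
  move=> /andP[w0 wa]; have w1 : w <= 1.
    by rewrite (le_trans wa)// invf_le1 ?lerDl ?ltW ?addr_gt0.
  by have [//|_ + _] := qP w; [rewrite w0|apply].
have e10 : 0 <= 1 - eps by rewrite subr_ge0 ltW.
have /cvgr0Pnorm_le/(_ _ eps0) Dq := stieltjes_horner_cvg q.
near=> t; have t0 : 0 < t by near: t; exact: nbhs_right_gt.
have : `|D (horner q) t| <= eps by near: t.
have S1t : S1 (cst 1) t <= L * c + 1 by near: t.
(* For the reference measure the powers of [t] cancel, so its normalized sublevel measure depends on
   the ratio [r] alone. *)
have F2 r : 0 < r -> t `^ (beta - s) * fine (nu [set x | v2 x < r * t]) =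
    M * r `^ (s - beta).
  move=> r0; rewrite nu_sublevel ?mulr_gt0// powRM ?ltW//.
  rewrite -[beta - s]opprB powRN.
  by field; rewrite gt_eqF// powR_gt0.
(* The lower bound for each measure is chained to the upper bound for the other through
   [|D q| <= eps]. The error [eps * (L * c + 2)] covers that [eps] and [eps] times the transform of
   [1]. *)
have := stieltjes_ge_measure mv1 v1_ge0 iK1 s_gt0 bq t0 eta0 e10 q0 qb.
have := stieltjes_ge_measure mv2 v2_ge0 iK2 s_gt0 bq t0 eta0 e10 q0 qb.
have := stieltjes_le_measure mv1 v1_ge0 iK1 s_gt0 bq t0 eta'0 (ltW eps0) q1 qa.
have := stieltjes_le_measure mv2 v2_ge0 iK2 s_gt0 bq t0 eta'0 (ltW eps0) q1 qa.
rewrite nu1// F2// -!mulrA F2//.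
move=> /(ler_wpM2l L_ge0) u2 u1 /(ler_wpM2l L_ge0) l2 l1.
rewrite ler_norml => /andP[ld ud].
have := ler_wpM2l (ltW eps0) S1t; have := mulr_ge0 L_ge0 c_ge0.
split; lra.
Unshelve. all: by end_near. Qed.

Theorem sublevel_asymptotics : phi r @[r --> 0^'+] --> L * M.
Proof.
apply/cvgrPdist_le => e e0.
have Z0 := mulr_ge0 L_ge0 M_ge0; set Z := L * M in Z0 *.
(* One [s] comes from the loss [A] in the kernel bound, and [s - beta] from the ratio [G] of the two
   normalized sublevel measures: [A / G = (1 + eta) ^ (- kappa)]. *)
pose kappa := s + (s - beta).
have kappa0 : 0 < kappa by rewrite ltr_pwDl// subr_ge0.
have e20 : 0 < e / 2 by rewrite divr_gt0.
have [eta /andP[eta0 _] etaP] := small_pos (kappa * (Z + e)) e20.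
have eta1 : 0 < 1 + eta by rewrite addr_gt0.
have eta'0 : 0 < eta * (1 + eta) by rewrite mulr_gt0.
pose E := eta `^ (s - beta); pose G := (1 + eta) `^ (s - beta).
have E0 : 0 < E by rewrite powR_gt0.
have G0 : 0 < G by rewrite powR_gt0.
pose A := (1 + eta) `^ (- s); have A0 : 0 < A by rewrite powR_gt0.
have EG : (eta * (1 + eta)) `^ (s - beta) = E * G by rewrite powRM ?ltW.
pose Y := (L * c + 2) / (E * G).
have EG0 : 0 < E * G by rewrite mulr_gt0.
have Lc := mulr_ge0 L_ge0 c_ge0.
have Y0 : 0 <= Y by apply: divr_ge0; [lra|exact: ltW].
have e40 : 0 < e / 4 by rewrite divr_gt0.
(* [eps] comes after [eta] because [Y] depends on [eta]. The choices give
   [(Z + e) (kappa * eta + eps) <= 3 / 4 * e] and [eps * Y <= e / 4], as [almost_equal] requires. *)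
have [eps eps01 epsP] := small_pos (Y + Z + e) e40.
have /andP[eps0 eps1] := eps01.
have ke0 : 0 < kappa * eta by rewrite mulr_gt0.
pose a := (1 - eps) * (A / G).
have aP : 1 - (kappa * eta + eps) <= a <= 1.
  have AG : A / G = (1 + eta) `^ (- kappa).
    rewrite /A /G /kappa opprD [RHS]powRD ?powRN//.
    by rewrite (gt_eqF eta1) implybT.
  have AG1 : A / G <= 1 by rewrite AG -[leRHS](powRr0 (1 + eta)) ler_powR//; lra.
  have AGp : 1 - kappa * eta <= A / G.
    by have /andP[+ _] := powRN_taylor kappa0 (ltW eta0); rewrite -AG subr_ge0.
  have := ler_wpM2l (ltW eps0) AG1; rewrite /a => h; apply/andP; split; last first.
    have : 0 <= eps * (A / G) by rewrite mulr_ge0 ?divr_ge0 ?ltW.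
    lra.
  lra.
have sw := sublevel_sandwich eta0 eps01.
have u0 : 0 < eta^-1 by rewrite invr_gt0.
have l0 : 0 < (eta * (1 + eta))^-1 by rewrite invr_gt0 mulr_gt0.
(* The sandwich is used at [t = r / eta] for the upper bound and at [t = r / (eta (1 + eta))] for
   the lower one, so that the sublevel set of [mu] is [v1 < r] both times. *)
have /near_right0P[du du0 swu] := near_right0_scale u0 sw.
have /near_right0P[dl dl0 swl] := near_right0_scale l0 sw.
apply/near_right0P; exists (Num.min du dl); first by rewrite lt_min du0.
move=> r; rewrite lt_min => /and3P[r0 rdu rdl].
set x := phi r; have x0 : 0 <= x by rewrite mulr_ge0 ?powR_ge0// fine_ge0.
have upper : a * x <= Z + eps * Y.
  have [+ _] := swu r (introT andP (conj r0 rdu)).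
  rewrite mulVKf ?gt_eqF// EG powRM ?(ltW u0) ?(ltW r0)//.
  rewrite -(powR_inv1 (ltW eta0)) -powRrM mulN1r opprB -/E -/A.
  have -> : Z + eps * Y = (L * (M * (E * G)) + eps * (L * c + 2)) / (E * G).
    by rewrite /Y /Z; field; rewrite !gt_eqF.
  rewrite ler_pdivlMr ?mulr_gt0//; congr (_ <= _).
  by rewrite /a /x; field; rewrite gt_eqF.
have lower : a * Z <= x + eps * Y.
  have [_ +] := swl r (introT andP (conj r0 rdl)).
  rewrite mulVKf ?gt_eqF ?mulr_gt0// powRM ?(ltW l0) ?(ltW r0)//.
  rewrite -(powR_inv1 (ltW eta'0)) -powRrM mulN1r opprB EG -/E -/A.
  have -> : x + eps * Y = (E * G * x + eps * (L * c + 2)) / (E * G).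
    by rewrite /Y; field; rewrite !gt_eqF.
  rewrite ler_pdivlMr ?mulr_gt0// /x !mulrA; congr (_ <= _).
  by rewrite /a /Z; field; rewrite gt_eqF.
apply: (almost_equal x0 Z0 e0 _ (proj1 (andP aP)) _ _ upper lower).
- by rewrite addr_ge0 ?ltW.
- have epsY : 0 <= eps * Y by apply: mulr_ge0 => //; exact: ltW.
  lra.
- have eZ : 0 <= eps * (Z + e).
    by apply: mulr_ge0; [exact: ltW|rewrite addr_ge0 ?(ltW e0)].
  lra.
Qed.

End tauberian.

(** * Scaling of Lebesgue measure and the Poisson profile *)

Section lebesgueRn_affine.
Context {R : realType} {m : nat}.
Local Notation V := (borelRn R m).

Lemma open_measurable_borelRn (U : set 'rV[R]_m) :
  open U -> measurable (U : set V).
Proof. exact: sub_sigma_algebra. Qed.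

Lemma continuous_measurable_borelRn (f : 'rV[R]_m -> R) :
  continuous f -> measurable_fun setT (f : V -> R).
Proof.
move=> /continuousP cf; apply: (measurability _ (RGenOpens.measurableE R)).
move=> _ [_ [a [b ->] <-]]; rewrite setTI.
by apply: open_measurable_borelRn; apply: cf; apply: interval_open.
Qed.

Lemma continuous_measurable_borelRn_id (f : 'rV[R]_m -> 'rV[R]_m) :
  continuous f -> measurable_fun setT (f : V -> V).
Proof.
move=> /continuousP cf.
apply: (@measurability _ _ _ V _ _ (@open 'rV[R]_m : set (set V))) => //.
by move=> _ [U oU <-]; rewrite setTI; apply: open_measurable_borelRn; exact: cf.
Qed.

(** Reversed endpoints are allowed and give an empty side, so the intersection of two boxes is a box
    without case distinction. *)
Definition open_box (a b : 'rV[R]_m) : set 'rV[R]_m :=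
  [set x | forall i, x ord0 i \in `]a ord0 i, b ord0 i[].

Lemma lebesgueRn_open_box (a b : 'rV[R]_m) :
  lebesgueRn (open_box a b : set V) =
  (\prod_(i < m) Num.max (b ord0 i - a ord0 i) 0)%:E.
Proof.
rewrite (@lebesgueRn_box R m (fun i => [set` `]a ord0 i, b ord0 i[]))//.
rewrite -prodEFin; apply: eq_bigr => i _; rewrite lebesgue_measure_itv/= lte_fin.
case: ltP => [ab|ba]; first by rewrite -EFinB max_l// subr_ge0 ltW.
by rewrite max_r// subr_le0.
Qed.

Lemma measurable_open_box (a b : 'rV[R]_m) : measurable (open_box a b : set V).
Proof.
rewrite (_ : open_box a b = \bigcap_(i in [set: 'I_m])
  (fun x : V => x ord0 i) @^-1` `]a ord0 i, b ord0 i[%classic).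
  apply: fin_bigcap_measurable => // i _; rewrite -[X in measurable X]setTI.
  apply: (continuous_measurable_borelRn (f := fun x => x ord0 i)) => //.
  exact: coord_continuous.
by apply/seteqP; split => x /= h i; [move=> _|]; exact: h.
Qed.

(** An open set is a countable union of sup-norm balls with rational centres, and these balls are
    boxes. Boxes thus form a generating system closed under intersection, on which measures can be
    compared. *)
Lemma measurable_borelRnE :
  @measurable _ V = <<s [set open_box p.1 p.2 | p in [set: 'rV[R]_m * 'rV[R]_m]] >>.
Proof.
apply/seteqP; split.
  apply: smallest_sub; first exact: smallest_sigma_algebra.
  move=> U oU; rewrite (open_rV_bigcup_ball oU) bigcup_mkcond.
  pose G := [set open_box p.1 p.2 | p in [set: 'rV[R]_m * 'rV[R]_m]].
  apply: (@countable_bigcupT_measurable _ (g_sigma_algebraType G)).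
    exact: countableP.
  move=> [q k]; case: ifP => // _; apply: sub_sigma_algebra.
  exists (\row_i (ratr (q ord0 i) - k.+1%:R^-1),
          \row_i (ratr (q ord0 i) + k.+1%:R^-1)) => //=.
  apply/seteqP; split => x /=.
    move=> h; split=> [|i j]; rewrite ?invr_gt0// !mxE ord1.
    have := h j; rewrite !mxE in_itv /= /ball/= -ltr_distlC distrC.
    by rewrite distrC.
  move=> [_ h] i; have := h ord0 i; rewrite !mxE /ball/= in_itv /=.
  by rewrite -ltr_distlC distrC.
apply: smallest_sub; first exact: sigma_algebra_measurable.
by move=> _ [p _ <-]; exact: measurable_open_box.
Qed.

Lemma measurable_affine (x0 : 'rV[R]_m) (r : R) :
  measurable_fun setT ((fun x => x0 + r *: x) : V -> V).
Proof.
apply: continuous_measurable_borelRn_id => x.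
apply: (@continuousD _ _ _ (fun=> x0) (fun y : 'rV[R]_m => r *: y)).
  exact: cst_continuous.
exact: scaler_continuous.
Qed.

(** Both sides are measures in [A]. They agree on open boxes, and the cubes [g n] exhaust the space
    with finite measure, so uniqueness of measures applies. *)
Lemma lebesgueRn_affine (x0 : 'rV[R]_m) (r : {posnum R}) (A : set V) :
  measurable A ->
  lebesgueRn A = ((r%:num ^+ m)%:E *
    lebesgueRn ([set x | A (x0 + r%:num *: x)%R] : set V))%E.
Proof.
move=> mA; have r0 : 0 < r%:num :> R by [].
pose f := (fun x => x0 + r%:num *: x) : V -> V.
have mf : measurable_fun setT f by exact: measurable_affine.
have [nu nuE] : exists nu : {measure set V -> \bar R},
    forall B, nu B = lebesgueRn (f @^-1` B).
  by unshelve eexists (pushforward (@lebesgueRn R m) f : {measure set V -> \bar R}).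
pose mu : {measure set V -> \bar R} := mscale (NngNum (exprn_ge0 m (ltW r0))) nu.
have muE B : mu B = ((r%:num ^+ m)%:E * lebesgueRn (f @^-1` B))%E by rewrite -nuE.
rewrite -[RHS](muE A).
pose G := [set open_box p.1 p.2 | p in [set: 'rV[R]_m * 'rV[R]_m]].
pose g n : set V := open_box (const_mx (- n%:R)) (const_mx n%:R).
apply: (@measure_unique _ R V G g) => //.
- exact: measurable_borelRnE.
- move=> _ _ [[a b] _ <-] [[a' b'] _ <-].
  exists (\row_i Num.max (a ord0 i) (a' ord0 i),
          \row_i Num.min (b ord0 i) (b' ord0 i)) => //.
  apply/seteqP; split => x /=.
    move=> h; split=> i; have := h i; rewrite !mxE !in_itv /= gt_max lt_min.
      by move=> /andP[/andP[-> _] /andP[-> _]].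
    by move=> /andP[/andP[_ ->] /andP[_ ->]].
  move=> [h h'] i; have := h i; have := h' i.
  by rewrite !mxE !in_itv /= gt_max lt_min => /andP[-> ->] /andP[-> ->].
- by move=> n; exists (const_mx (- n%:R), const_mx n%:R).
- rewrite -subTset => x _.
  (* One more than the sum of the integer parts of all [|x_i|] exceeds each [|x_i|]. *)
  exists (\sum_(i < m) Num.truncn `|x ord0 i|).+1 => //= i.
  rewrite !mxE in_itv /= -ltr_norml.
  apply: (lt_le_trans (truncnS_gt _)); rewrite ler_nat ltnS.
  by rewrite (bigD1 i)//= leq_addr.
- move=> _ [[a b] _ <-]; rewrite muE.
  have -> : f @^-1` open_box a b =
      open_box (r%:num^-1 *: (a - x0)) (r%:num^-1 *: (b - x0)).
    apply/seteqP; split => x /= h i; have := h i; rewrite !mxE !in_itv /=.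
      rewrite !(mulrC (_^-1)) ltr_pdivrMr// ltr_pdivlMr//.
      by rewrite ltrBlDl ltrBrDl (mulrC (x _ _)).
    rewrite !(mulrC (_^-1)) ltr_pdivrMr// ltr_pdivlMr//.
    by rewrite ltrBlDl ltrBrDl (mulrC (x _ _)).
  rewrite [LHS](lebesgueRn_open_box a b) lebesgueRn_open_box -EFinM; congr (_%:E).
  rewrite -[X in _ ^+ X]card_ord -prodr_const -big_split; apply: eq_bigr => i _ /=.
  rewrite !mxE maxr_pMr ?mulr0//; congr Num.max.
  by rewrite -mulrBr mulVKf ?gt_eqF//; ring.
- move=> n.
  by rewrite [X in (X < _)%E](lebesgueRn_open_box
    (const_mx (- n%:R)) (const_mx n%:R)) ltry.
Qed.

End lebesgueRn_affine.

(** * Volume of Euclidean balls and the mass of the Poisson profile *)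

Section lebesgueRn_radial.
Context {R : realType} {m : nat}.
Local Notation V := (borelRn R m).
Local Notation leb := (@lebesgueRn R m).

Lemma ge0_integral_affine (x0 : 'rV[R]_m) (r : {posnum R}) (f : V -> \bar R) :
  measurable_fun setT f -> (forall x, 0 <= f x)%E ->
  (\int[leb]_x f x =
   (r%:num ^+ m)%:E * \int[leb]_x f (x0 + r%:num *: x)%R)%E.
Proof.
move=> mf f0; pose phi := (fun x => x0 + r%:num *: x) : V -> V.
have mphi : measurable_fun setT phi by exact: measurable_affine.
have r0 : 0 <= r%:num ^+ m by rewrite exprn_ge0.
have [nu nuE] : exists2 nu : {measure set V -> \bar R},
    (nu : set V -> \bar R) = pushforward leb phi &
    (\int[nu]_x f x = \int[leb]_x (f \o phi) x)%E.
  unshelve eexists (pushforward leb phi : {measure set V -> \bar R}) => //.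
  by rewrite ge0_integral_pushforward.
move=> nuf.
rewrite (@eq_measure_integral _ _ _ _ (mscale (NngNum r0) nu)).
  by rewrite ge0_integral_mscale// nuf.
move=> A mA _; rewrite [LHS](lebesgueRn_affine x0 r mA); congr (_ * _)%E.
by rewrite -[LHS]/(pushforward leb phi A) -nuE.
Qed.

Lemma enorm_sqr (x : 'rV[R]_m) : enorm x ^+ 2 = \sum_(i < m) x ord0 i ^+ 2.
Proof. by rewrite sqr_sqrtr// sumr_ge0// => i _; exact: sqr_ge0. Qed.

Lemma enorm_sqrZ (r : R) (x : 'rV[R]_m) :
  enorm (r *: x) ^+ 2 = r ^+ 2 * enorm x ^+ 2.
Proof.
by rewrite !enorm_sqr mulr_sumr; apply: eq_bigr => i _; rewrite mxE exprMn.
Qed.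

Lemma enorm_ge0 (x : 'rV[R]_m) : 0 <= enorm x.
Proof. exact: sqrtr_ge0. Qed.

Lemma enormN (x : 'rV[R]_m) : enorm (- x) = enorm x.
Proof.
by congr Num.sqrt; apply: eq_bigr => i _; rewrite mxE sqrrN.
Qed.

Lemma measurable_enorm_sqr (x0 : 'rV[R]_m) :
  measurable_fun setT (fun x : V => enorm (x0 - x) ^+ 2).
Proof.
under eq_fun do rewrite enorm_sqr.
apply: measurable_sum => i; apply: measurable_funX.
apply: (continuous_measurable_borelRn (f := fun x => (x0 - x) ord0 i)) => x.
under eq_fun do rewrite !mxE.
apply: (@continuousB _ _ _ (fun=> x0 ord0 i) (fun y : 'rV[R]_m => y ord0 i)).
  exact: cst_continuous.
exact: coord_continuous.
Qed.

Definition unit_ball_volume : R := fine (leb [set x | enorm x ^+ 2 < 1]).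

Let measurable_unit_ball : measurable ([set x | enorm x ^+ 2 < 1] : set V).
Proof.
have := measurable_sublevel 1 (measurable_enorm_sqr 0).
by congr measurable; apply/seteqP; split => x /=; rewrite sub0r enormN.
Qed.

Let cube (r : R) : set V := open_box (const_mx (- r)) (const_mx r).

Let lebesgueRn_cube r : 0 <= r -> leb (cube r) = ((2 * r) ^+ m)%:E.
Proof.
move=> r0; rewrite lebesgueRn_open_box; congr (_%:E).
rewrite -[X in _ ^+ X]card_ord -prodr_const; apply: eq_bigr => i _.
by rewrite !mxE opprK mulr_natl -mulr2n max_l// mulrn_wge0.
Qed.

Lemma lebesgueRn_unit_ball :
  leb [set x | enorm x ^+ 2 < 1] = unit_ball_volume%:E.
Proof.
rewrite fineK// ge0_fin_numE//.
apply: (@le_lt_trans _ _ (leb (cube 1))); last by rewrite lebesgueRn_cube ?ltry.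
apply: le_measure; rewrite ?inE//; first exact: measurable_open_box.
move=> x /= x1 i; rewrite !mxE in_itv /= -ltr_norml -(ltr_pXn2r (ltn0Sn 1)) ?nnegrE//.
rewrite real_normK ?num_real// expr1n; apply: le_lt_trans x1.
rewrite enorm_sqr (bigD1 i)//= lerDl sumr_ge0// => j _; exact: sqr_ge0.
Qed.

Lemma unit_ball_volume_gt0 : 0 < unit_ball_volume.
Proof.
rewrite -lte_fin -lebesgueRn_unit_ball.
(* Since [m * d ^ 2 < 1], the cube of half-side [d] lies in the unit ball; the successor covers
   [m = 0] too. *)
pose d : R := m.+1%:R^-1; have d0 : 0 < d by rewrite invr_gt0.
apply: (@lt_le_trans _ _ (leb (cube d))).
  by rewrite lebesgueRn_cube ?ltW// lte_fin exprn_gt0// mulr_gt0.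
apply: le_measure; rewrite ?inE//; first exact: measurable_open_box.
move=> x /= xd; rewrite enorm_sqr.
apply: (@le_lt_trans _ _ (\sum_(i < m) d ^+ 2)).
  apply: ler_sum => i _; have := xd i; rewrite !mxE in_itv /= -ltr_norml => /ltW.
  by move=> h; rewrite -(real_normK (num_real (x _ _))) lerXn2r// nnegrE ltW.
rewrite sumr_const card_ord -mulr_natr /d.
rewrite exprVn -mulrC ltr_pdivrMr ?exprn_gt0// mul1r -natrX ltr_nat.
by rewrite (leq_trans (ltnSn m))// leq_pmulr.
Qed.

(** The set is the image of the unit ball under [x -> x0 + sqrt r x]; the exponent is halved because
    [r] is a squared radius. *)
Lemma lebesgueRn_sublevel (x0 : 'rV[R]_m) (r : R) : 0 < r ->
  leb [set x | enorm (x0 - x) ^+ 2 < r] =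
  (unit_ball_volume * r `^ (m%:R / 2))%:E.
Proof.
move=> r0; have s0 : 0 < Num.sqrt r by rewrite sqrtr_gt0.
rewrite [LHS](lebesgueRn_affine x0 (PosNum s0)); last first.
  exact: (measurable_sublevel _ (measurable_enorm_sqr x0)).
rewrite EFinM muleC -lebesgueRn_unit_ball; congr (_ * _)%E.
  congr lebesgueRn; apply/seteqP; split => x /=;
    by rewrite opprD addNKr enormN enorm_sqrZ (sqr_sqrtr (ltW r0)) gtr_pMr.
congr (_%:E); rewrite /= -powR12_sqrt ?(ltW r0)// -powR_mulrn ?powR_ge0//.
by rewrite -powRrM mulrC.
Qed.

Variable s : R.
Hypothesis s_gt : m%:R / 2 < s.
Let K (x : V) : \bar R := ((1 + enorm (0 - x) ^+ 2) `^ (- s))%:E.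

Lemma measurable_profile : measurable_fun setT K.
Proof.
apply/measurable_EFinP.
rewrite (_ : (fun x => _) = (@powR R)^~ (- s) \o (fun x : V => 1 + enorm (0 - x) ^+ 2))//.
apply: measurableT_comp; first exact: measurable_powR.
by apply: measurable_funD => //; exact: measurable_enorm_sqr.
Qed.

Let K_ge0 x : (0 <= K x)%E.
Proof. by rewrite lee_fin powR_ge0. Qed.

(* Dyadic decomposition: on [4 ^ (k - 1) <= |x| ^ 2 < 4 ^ k] the integrand is
   at most [4 ^ (- s (k - 1))]. *)
Lemma integral_profile_lty : (\int[leb]_x K x < +oo)%E.
Proof.
pose b : R := 4 `^ (- s); have n4 : 0 < 4 :> R by [].
have b0 : 0 < b by rewrite powR_gt0.
have s0 : 0 < s by rewrite (le_lt_trans _ s_gt)// divr_ge0.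
have b1 : 1 <= b^-1.
  rewrite /b powRN invrK -[leLHS](powRr0 4).
  by apply: ler_powR; [rewrite ler1n|exact: ltW].
(* Ratio of the dominating geometric series: decay [b] of the integrand against growth [4 ^ (m / 2)]
   of the volume. It is below [1] because [m / 2 < s]. *)
pose q : R := b * 4 `^ (m%:R / 2).
have q0 : 0 < q by rewrite mulr_gt0 ?powR_gt0.
have q1 : q < 1.
  rewrite /q /b -powRD ?(gt_eqF n4) ?implybT// /powR (gt_eqF n4) expR_lt1.
  by rewrite pmulr_llt0 ?ln_gt0 ?ltr1n// addrC subr_lt0.
pose B k := [set x : V | enorm (0 - x) ^+ 2 < 4 ^+ k].
have mB k : measurable (B k) by exact: (measurable_sublevel _ (measurable_enorm_sqr 0)).
(* The bound for a shell is placed on the whole ball [B k]; overcounting is harmless, since the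
   series only has to dominate. *)
pose f k (x : V) : \bar R := (b^-1 * b ^+ k * \1_(B k) x)%:E.
have f0 k x : (0 <= f k x)%E.
  by rewrite lee_fin !mulr_ge0 ?invr_ge0 ?exprn_ge0 ?(ltW b0).
have mf k : measurable_fun setT (f k).
  by apply/measurable_EFinP/measurable_funM => //; exact: measurable_indic.
have Kf x : (K x <= \sum_(k <oo) f k x)%E.
  have v0 : 0 <= enorm (0 - x) ^+ 2 by exact: sqr_ge0.
  have vB k : enorm (0 - x) ^+ 2 < 4 ^+ k -> x \in B k by move=> ?; rewrite inE.
  rewrite /K /f; move: (enorm (0 - x) ^+ 2) v0 vB => v v0 vB.
  have ex4 : exists k, v < 4 ^+ k.
    exists (Num.truncn v).+1; apply: (lt_trans (truncnS_gt v)).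
    by rewrite -natrX ltr_nat ltn_expl.
  case: (ex_minnP ex4) => k vk kmin.
  have : (((1 + v) `^ (- s))%:E <= f k x)%E.
    rewrite /f lee_fin indicE vB// mulr1.
    (* For [k = 0] there is no inner radius, and the bound is [1 <= b^-1]. *)
    case: k vk kmin => [|k] _ kmin.
      rewrite expr0 mulr1 (le_trans _ b1)// -[leRHS](powRr0 (1 + v)).
      by apply: ler_powR; [rewrite lerDl|rewrite oppr_le0 ltW].
    rewrite [b ^+ _]exprS mulKf ?gt_eqF// /b -powR_mulrn ?powR_ge0// powRAC powR_mulrn//.
    rewrite !powRN lef_pV2 ?posrE ?powR_gt0 ?exprn_gt0 ?ltr_pwDl//.
    have v4 : 4 ^+ k <= v by rewrite leNgt; apply/negP => /kmin; rewrite ltnn.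
    apply: ge0_ler_powR; rewrite ?nnegrE ?exprn_ge0 ?addr_ge0 ?(ltW s0)//.
    by rewrite (le_trans v4)// lerDr.
  move=> /le_trans; apply; apply: (le_trans _ (nneseries_lim_ge k.+1 _)); last first.
    by move=> i _ _; exact: f0.
  rewrite big_mkord big_ord_recr /= leeDr// sume_ge0// => i _; exact: f0.
have intf k : (\int[leb]_x f k x = (b^-1 * unit_ball_volume * q ^+ k)%:E)%E.
  rewrite /f; under eq_integral do rewrite EFinM.
  rewrite ge0_integralZl//; last 2 first.
  - by apply/measurable_EFinP; exact: measurable_indic.
  - by rewrite lee_fin mulr_ge0 ?invr_ge0 ?exprn_ge0 ?(ltW b0).
  rewrite integral_indic// setIT [X in (_ * X)%E](lebesgueRn_sublevel 0 (exprn_gt0 k n4)).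
  rewrite -EFinM.
  congr (_%:E); rewrite /q exprMn -[4 ^+ k]powR_mulrn// powRAC powR_mulrn ?powR_ge0//.
  by ring.
have mK := measurable_profile.
apply: (@le_lt_trans _ _ (\int[leb]_x (\sum_(k <oo) f k x))%E).
  apply: ge0_le_integral => //.
  by apply: ge0_emeasurable_sum.
rewrite integral_nneseries//; under eq_eseriesr do rewrite intf.
pose c := b^-1 * unit_ball_volume; have c0 : 0 <= c.
  by rewrite mulr_ge0 ?invr_ge0 ?(ltW b0)// ltW// unit_ball_volume_gt0.
apply: (@le_lt_trans _ _ (c / (1 - q))%:E); last by rewrite ltry.
apply: lime_le.
  by apply: is_cvg_nneseries => n _ _; rewrite lee_fin mulr_ge0 ?exprn_ge0 ?(ltW q0).
apply: nearW => n; rewrite /eseries/= sumEFin lee_fin -mulr_sumr.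
rewrite ler_wpM2l// -[leRHS]mul1r ler_pdivlMr ?subr_gt0// mulrC big_mkord.
by rewrite -opprB mulNr -subrX1 opprB lerBlDl lerDr exprn_ge0 ?(ltW q0).
Qed.

(** The profile is at least [2 ^ (- s)] on the unit ball, which has positive volume. *)
Lemma integral_profile_gt0 : (0 < \int[leb]_x K x)%E.
Proof.
pose B := [set x : V | enorm (0 - x) ^+ 2 < 1].
have mB : measurable B by exact: (measurable_sublevel _ (measurable_enorm_sqr 0)).
apply: (@lt_le_trans _ _ (\int[leb]_(x in B) (cst (2 `^ (- s))%:E) x)%E).
  rewrite integral_cst// [X in (_ * X)%E](lebesgueRn_sublevel 0 ltr01).
  rewrite powR1 mulr1 -EFinM lte_fin.
  by rewrite mulr_gt0 ?powR_gt0// unit_ball_volume_gt0.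
apply: (@le_trans _ _ (\int[leb]_(x in B) K x)%E).
  apply: ge0_le_integral => //.
  - by move=> x _; rewrite lee_fin powR_ge0.
  - by apply: measurable_funTS; exact: measurable_profile.
  - move=> x /= x1; rewrite /K lee_fin !powRN lef_pV2 ?posrE ?powR_gt0
      ?ltr_wpDr ?sqr_ge0//.
    apply: ge0_ler_powR; rewrite ?nnegrE ?addr_ge0 ?sqr_ge0//.
      by rewrite (le_trans _ (ltW s_gt))// divr_ge0.
    by rewrite -natr1 addrC lerD2r ltW.
by apply: ge0_subset_integral => //; exact: measurable_profile.
Qed.

(** Substituting [x = x0 + sqrt t z] turns [t + |x0 - x| ^ 2] into [t (1 + |z| ^ 2)], and the powers
    of [t] cancel because [m / 2 + beta - s = 0]. *)
Lemma integral_kernel (beta t : R) (x0 : 'rV[R]_m) : s = beta + m%:R / 2 -> 0 < t ->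
  (\int[leb]_x (stieltjes_kernel beta s t (enorm (x0 - x) ^+ 2))%:E =
  \int[leb]_x K x)%E.
Proof.
move=> sE t0; have r0 : 0 < Num.sqrt t by rewrite sqrtr_gt0.
have mk : measurable_fun setT
    (fun x : V => (stieltjes_kernel beta s t (enorm (x0 - x) ^+ 2))%:E).
  apply/measurable_EFinP; apply: measurable_stieltjes_kernel.
  exact: measurable_enorm_sqr.
rewrite (ge0_integral_affine x0 (PosNum r0) mk); last first.
  by move=> x; rewrite lee_fin stieltjes_kernel_ge0.
pose a := t `^ (beta - s).
have -> : (\int[leb]_x (stieltjes_kernel beta s t
    (enorm (x0 - (x0 + (PosNum r0)%:num *: x)) ^+ 2))%:E = \int[leb]_x (a%:E * K x))%E.
  apply: eq_integral => x _; rewrite /K -EFinM; congr (_%:E).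
  rewrite /= opprD addNKr sub0r !enormN enorm_sqrZ (sqr_sqrtr (ltW t0)).
  rewrite /stieltjes_kernel -[X in (X + _) `^ _]mulr1 -mulrDr.
  rewrite powRM ?addr_ge0 ?sqr_ge0 ?(ltW t0)//.
  by rewrite mulrA -powRD ?(gt_eqF t0) ?implybT.
have mK := measurable_profile; rewrite ge0_integralZl ?lee_fin ?powR_ge0//.
rewrite muleA -EFinM /a /= -powR12_sqrt ?(ltW t0)// -powR_mulrn ?powR_ge0//.
rewrite -powRrM -powRD ?(gt_eqF t0) ?implybT//.
by rewrite [X in _ `^ X](_ : _ = 0) ?powRr0 ?mul1e// sE; field.
Qed.

End lebesgueRn_radial.

(** * Boundary measures *)

Section poisson.
Context {R : realType} (n : nat) (n_ge2 : (2 <= n)%N).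
Variables (beta : R) (beta_gt0 : 0 < beta).
Local Notation V := (borelRn R n.-1).
Local Notation s := (rho n + beta).
Local Notation K := (stieltjes_kernel beta s).

Lemma rhoE : rho n = n.-1%:R / 2 :> R.
Proof. by rewrite /rho -[in LHS](ltn_predK n_ge2) mulrSr addrK. Qed.

Lemma rho_gt0 : 0 < rho n :> R.
Proof. by rewrite rhoE divr_gt0// ltr0n -ltnS (ltn_predK n_ge2). Qed.

Let s_gt0 : 0 < s.
Proof. by rewrite addr_gt0 ?rho_gt0. Qed.

Let s_gt : n.-1%:R / 2 < s.
Proof. by rewrite -rhoE ltrDl. Qed.

Let sE : s = beta + n.-1%:R / 2.
Proof. by rewrite -rhoE addrC. Qed.

(** The exponents of [y] match: [2 beta = (beta - rho) + (rho + beta)]. This is how the normalizing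
    factor [y ^ (beta - rho)] of the limit enters. *)
Lemma poisson_profileE (x : 'rV[R]_n.-1) (y : R) : 0 < y ->
  K (y ^+ 2) (enorm x ^+ 2) = y `^ (beta - rho n) * poisson_profile beta x y.
Proof.
move=> y0; have y2 : 0 < y ^+ 2 by rewrite exprn_gt0.
have yx : 0 < y ^+ 2 + enorm x ^+ 2 by rewrite ltr_pwDl ?sqr_ge0.
rewrite /stieltjes_kernel /poisson_profile powRM ?invr_ge0 ?(ltW y0) ?(ltW yx)//.
rewrite mulrA -powRD ?(gt_eqF y0) ?implybT// -[X in X `^ beta]powR_mulrn ?(ltW y0)//.
rewrite -powRrM -[(_ + _)^-1](powR_inv1 (ltW yx)) -powRrM mulN1r.
by congr (_ `^ _ * _); ring.
Qed.

Definition profile_mass : R :=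
  fine (\int[@lebesgueRn R n.-1]_x ((1 + enorm (0 - x) ^+ 2) `^ (- s))%:E).

Let profile_massE : (\int[@lebesgueRn R n.-1]_x
  ((1 + enorm (0 - x) ^+ 2) `^ (- s))%:E = profile_mass%:E)%E.
Proof.
by rewrite fineK// gt0_fin_numE ?integral_profile_gt0// integral_profile_lty.
Qed.

Lemma profile_mass_gt0 : 0 < profile_mass.
Proof. by rewrite -lte_fin -profile_massE integral_profile_gt0. Qed.

(** The constant is obtained by choice, so the set of candidates has to be shown nonempty; the
    inverse of the finite, positive [profile_mass] belongs to it. *)
Lemma poisson_constP :
  0 < @poisson_const R n beta /\ poisson_const n beta * profile_mass = 1.
Proof.
have profE (x : 'rV[R]_n.-1) :
    poisson_profile beta x 1 = (1 + enorm (0 - x) ^+ 2) `^ (- s).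
  have := poisson_profileE x ltr01; rewrite powR1 mul1r => <-.
  by rewrite /stieltjes_kernel expr1n powR1 mul1r sub0r enormN.
have intE d : 0 < d ->
    (\int[@lebesgueRn R n.-1]_x (d * poisson_profile beta x 1)%:E =
     (d * profile_mass)%:E)%E.
  move=> d0; rewrite EFinM -profile_massE.
  under eq_integral do rewrite profE EFinM.
  rewrite ge0_integralZl//.
  - exact: measurable_profile.
  - by move=> x _; rewrite lee_fin powR_ge0.
  - by rewrite lee_fin ltW.
have [d0 dE] : [set d : R | 0 < d /\
    (\int[@lebesgueRn R n.-1]_x (d * poisson_profile beta x 1)%:E = 1)%E]
    (poisson_const n beta).
  apply: getPex; exists profile_mass^-1; split.
    by rewrite invr_gt0 profile_mass_gt0.
  by rewrite intE ?invr_gt0 ?profile_mass_gt0// mulVf ?gt_eqF ?profile_mass_gt0.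
by split=> //; move: dE; rewrite intE// => -[].
Qed.

Let v (x0 : 'rV[R]_n.-1) (x : V) : R := enorm (x0 - x) ^+ 2.

Lemma lebesgue_stieltjes_kernel (x0 : 'rV[R]_n.-1) (t : R) : 0 < t ->
  (@lebesgueRn R n.-1).-integrable setT (EFin \o (fun x => K t (v x0 x))) /\
  stieltjes beta s (@lebesgueRn R n.-1) (v x0) (cst 1) t = profile_mass.
Proof.
move=> t0; have kE := integral_kernel x0 sE t0.
have mk : measurable_fun setT (fun x : V => K t (v x0 x)).
  by apply: measurable_stieltjes_kernel; exact: measurable_enorm_sqr.
split.
  apply/integrableP; split; first exact/measurable_EFinP.
  under eq_integral => x _ do
    rewrite /= ger0_norm ?stieltjes_kernel_ge0//.
  by rewrite kE profile_massE ltry.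
rewrite /stieltjes/Rintegral; under eq_integral => x _ do rewrite /= mulr1.
by rewrite kE profile_massE.
Qed.

Variables (u : 'rV[R]_n.-1 * R -> R) (mu : {measure set V -> \bar R}).
Hypothesis u_mu : boundary_measure beta u mu.

(** Multiply the representation of [u] by [profile_mass * y ^ (beta - rho)] and use that
    [profile_mass] inverts [poisson_const]. *)
Lemma boundary_stieltjes_kernel (x0 : 'rV[R]_n.-1) :
  exists C : R, forall y, 0 < y ->
  mu.-integrable setT (EFin \o (fun x => K (y ^+ 2) (v x0 x))) /\
  stieltjes beta s mu (v x0) (cst 1) (y ^+ 2) =
    profile_mass * (y `^ (beta - rho n) * u (x0, y) - C * y `^ (2 * beta)).
Proof.
have [_ [C C0 uE]] := u_mu; exists C => y y0.
have [d0 dc] := poisson_constP.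
pose d := poisson_const n beta.
have y2 : 0 < y ^+ 2 by rewrite exprn_gt0.
have mk : measurable_fun setT (fun x : V => K (y ^+ 2) (v x0 x)).
  by apply: measurable_stieltjes_kernel; exact: measurable_enorm_sqr.
have kE x : poisson_kernel beta (x0 - x) y =
    (d * y `^ (rho n - beta)) * K (y ^+ 2) (v x0 x).
  rewrite /v poisson_profileE// mulrA -[d * _ * _]mulrA -powRD ?(gt_eqF y0) ?implybT//.
  by rewrite addrC subrKA subrr powRr0 mulr1.
have a0 : 0 < d * y `^ (rho n - beta) by rewrite mulr_gt0 ?powR_gt0.
have TE : poisson_transform beta mu x0 y =
    ((d * y `^ (rho n - beta))%:E * \int[mu]_x (K (y ^+ 2) (v x0 x))%:E)%E.
  rewrite /poisson_transform; under eq_integral do rewrite kE EFinM.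
  rewrite ge0_integralZl//.
  - exact/measurable_EFinP.
  - by move=> x _; rewrite lee_fin stieltjes_kernel_ge0.
  - by rewrite lee_fin ltW.
have := uE x0 y y0; rewrite TE => uE'.
have IE : (\int[mu]_x (K (y ^+ 2) (v x0 x))%:E)%E =
    (profile_mass * (y `^ (beta - rho n) * u (x0, y) - C * y `^ (2 * beta)))%:E.
  (* Integrability comes from [u] being real-valued: an infinite integral would make the right-hand
     side infinite. *)
  move: uE'; case: (\int[mu]_x _)%E => [I| |].
  - move=> -[->]; congr (_%:E).
    have e1 : y `^ (beta - rho n) * y `^ (beta + rho n) = y `^ (2 * beta).
      by rewrite -powRD ?(gt_eqF y0) ?implybT//; congr (_ `^ _); ring.
    have e2 : y `^ (beta - rho n) * y `^ (rho n - beta) = 1.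
      by rewrite -powRD ?(gt_eqF y0) ?implybT// addrC subrKA subrr powRr0.
    rewrite [RHS](_ : _ = profile_mass * (C * (y `^ (beta - rho n) * y `^ (beta + rho n))
      + d * (y `^ (beta - rho n) * y `^ (rho n - beta)) * I - C * y `^ (2 * beta)));
      last ring.
    by rewrite e1 e2 mulr1 addrAC subrr add0r mulrA [_ * d]mulrC dc mul1r.
  - by rewrite gt0_muley ?lte_fin.
  - by rewrite gt0_muleNy ?lte_fin.
split.
  apply/integrableP; split; first exact/measurable_EFinP.
  under eq_integral => x _ do
    rewrite /= ger0_norm ?stieltjes_kernel_ge0//.
  by rewrite IE ltry.
rewrite /stieltjes/Rintegral; under eq_integral => x _ do rewrite /= mulr1.
by rewrite IE.
Qed.

End poisson.

(** * Vertical limits of eigenfunctions and symmetric derivatives of boundary measures *)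

Theorem theorem3p2 (R : realType) (n : nat) (n_ge2 : (2 <= n)%N)
    (beta : R) (beta_gt0 : 0 < beta)
    (u : 'rV[R]_n.-1 * R -> R)
    (mu : {measure set (borelRn R n.-1) -> \bar R})
    (u_ge0 : forall p, half_space p -> 0 <= u p)
    (u_eigen : eigenfunctionH (beta ^+ 2 - rho n ^+ 2) u)
    (u_mu : boundary_measure beta u mu)
    (x0 : 'rV[R]_n.-1) (L : R) (L_ge0 : 0 <= L)
    (u_lim : y `^ (beta - rho n) * u (x0, y) @[y --> 0^'+] --> L) :
  is_symmetric_derivative mu x0 L.
Proof.
have s_gt0 : 0 < rho n + beta by rewrite addr_gt0// rho_gt0.
pose v (x : borelRn R n.-1) : R := enorm (x0 - x) ^+ 2.
have mv : measurable_fun setT v by exact: measurable_enorm_sqr.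
have v0 x : 0 <= v x by exact: sqr_ge0.
have [C muP] := boundary_stieltjes_kernel n_ge2 beta_gt0 u_mu x0.
have sqrtK (t : R) : 0 < t -> Num.sqrt t ^+ 2 = t by move=> /ltW/sqr_sqrtr.
have iK1 t : 0 < t ->
    mu.-integrable setT (EFin \o (fun x => stieltjes_kernel beta (rho n + beta) t (v x))).
  move=> t0; have r0 : 0 < Num.sqrt t by rewrite sqrtr_gt0.
  by have [+ _] := muP _ r0; rewrite sqrtK.
have lebP t t0 := @lebesgue_stieltjes_kernel R n n_ge2 beta beta_gt0 x0 t t0.
have lim1 : stieltjes beta (rho n + beta) mu v (cst 1) t @[t --> 0^'+] -->
    L * profile_mass n beta.
  (* The contribution of [C] vanishes in the limit since [2 * beta > 0]. *)
  have lim0 : profile_mass n beta *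
      (y `^ (beta - rho n) * u (x0, y) - C * y `^ (2 * beta)) @[y --> 0^'+] --> profile_mass n beta * (L - C * 0).
    apply: cvgMl_tmp; apply: cvgB => //; apply: cvgMl_tmp.
    by apply: powR_cvg0; rewrite mulr_gt0.
  rewrite mulr0 subr0 [profile_mass n beta * L]mulrC in lim0.
  have limsqrt := cvg_comp _ _ sqrt_cvg_right0 lim0.
  move: limsqrt; apply: cvg_trans; apply: near_eq_cvg; near=> t.
  have t0 : 0 < t by near: t; exact: nbhs_right_gt.
  have r0 : 0 < Num.sqrt t by rewrite sqrtr_gt0.
  by have [_] := muP _ r0; rewrite sqrtK.
have bs : beta <= rho n + beta by rewrite lerDr ltW// rho_gt0.
have ball r : 0 < r -> lebesgueRn ([set x | v x < r] : set (borelRn R n.-1)) =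
    (@unit_ball_volume R n.-1 * r `^ (rho n))%:E.
  by move=> r0; rewrite lebesgueRn_sublevel// rhoE.
have leb_sub r : 0 < r -> fine (@lebesgueRn R n.-1 [set x | v x < r]) =
    @unit_ball_volume R n.-1 * r `^ (rho n + beta - beta).
  by move=> r0; rewrite addrK ball.
(* Lebesgue measure is the reference: [c] is [profile_mass], [M] is the volume of the unit ball, and
   [s - beta = rho]. *)
have := sublevel_asymptotics s_gt0 mv v0 mv v0 iK1 (fun t t0 => (lebP t t0).1)
  L_ge0 (fun t t0 => (lebP t t0).2) lim1 bs leb_sub.
move=> lim2.
have W0 := @unit_ball_volume_gt0 R n.-1.
have lim3 : (r ^+ 2) `^ (beta - (rho n + beta)) * fine (mu [set x | v x < r ^+ 2]) /
    @unit_ball_volume R n.-1 @[r --> 0^'+] --> L.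
  rewrite -[L in _ --> L](mulfK (lt0r_neq0 W0)); apply: cvgMr_tmp.
  exact: (cvg_comp _ _ sqr_cvg_right0 lim2).
have eballE r : 0 < r -> eball x0 r = [set x | v x < r ^+ 2].
  move=> r0; apply/seteqP; split => x; rewrite /eball /v /= -opprB enormN;
    by rewrite ltr_pXn2r// nnegrE ?enorm_ge0 ?ltW.
(* Both measures of the ball are finite and the Lebesgue one is nonzero, so the extended quotient is
   a quotient of reals. *)
have quotientE r : 0 < r ->
    (mu (eball x0 r) / lebesgueRn (eball x0 r : set (borelRn R n.-1)))%E =
    ((r ^+ 2) `^ (beta - (rho n + beta)) * fine (mu [set x | v x < r ^+ 2]) /
      @unit_ball_volume R n.-1)%:E.
  move=> r0; have r2 : 0 < r ^+ 2 by rewrite exprn_gt0.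
  have muoo := sublevel_lty mv v0 iK1 s_gt0 r2.
  rewrite eballE// ball// -[X in (X / _)%E]fineK ?ge0_fin_numE//.
  rewrite inver mulf_eq0 (gt_eqF W0) (gt_eqF (powR_gt0 _ r2)) /= -EFinM.
  congr (_%:E); rewrite opprD addrCA subrr addr0 powRN.
  by field; rewrite !gt_eqF ?powR_gt0.
apply/fine_cvgP; split.
  by near=> r; rewrite quotientE//; near: r; exact: nbhs_right_gt.
move: lim3; apply: cvg_trans; apply: near_eq_cvg; near=> r.
by rewrite /= quotientE//; near: r; exact: nbhs_right_gt.
Unshelve. all: by end_near. Qed.
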